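(* Let $n\in\mathbb N$ and let $\Omega\subset\mathbb R^n$ be non-empty, open and proper (i.e. $\Omega\ne\mathbb R^n$). Then there is a constant $c\ge 1$ depending only on $n$ such that, for every $m\in\mathbb N$, the space $(\mathcal B_m(\Omega),Wb_2)$ of unordered tuples of at most $m$ points of $\Omega$ admits a bi-Lipschitz embedding into Hilbert space with distortion at most $c\,m^{n+5/2}$.
   Context: $[\![x]\!]$ denotes the Dirac mass at $x$, and ''measure'' means non-negative Borel measure; $\mathcal M(Y)$ is the set of Borel measures on $Y$. With $X=\mathbb R^n$ and $d(x,y)=\|x-y\|$ the Euclidean distance, for $\mu,\nu\in\mathcal M(\Omega)$ define $$Wb_2(\mu,\nu)=\inf_\gamma\Big(\int_{X\times X}d(x,y)^2\,\mathrm d\gamma(x,y)\Big)^{1/2},$$ where the infimum is over all $\gamma\in\mathcal M(X\times X)$ whose coordinate projections (push-forwards under $(x,y)\mapsto x$ and $(x,y)\mapsto y$) $\pi_1\gamma,\pi_2\gamma$ satisfy $(\pi_1\gamma)|_\Omega=\mu$ and $(\pi_2\gamma)|_\Omega=\nu$ (no constraint is imposed outside $\Omega$). The space of unordered tuples of at most $m$ points is $$\mathcal B_m(\Omega)=\bigcup_{k=1}^m\Big\{\sum_{i=1}^k[\![x_i]\!]:x_1,\dots,x_k\in\Omega\Big\},$$ equipped with the metric $Wb_2$. Hilbert space means the separable infinite-dimensional Hilbert space $\ell_2$. The distortion of an injective map $f$ between metric spaces is $\operatorname{Lip}(f)\cdot\operatorname{Lip}(f^{-1})$, where $\operatorname{Lip}$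 is the Lipschitz constant and $f^{-1}$ is defined on the image of $f$; $f$ is bi-Lipschitz if its distortion is finite. *)

(* Defs.v *)
From HB Require Import structures.
From mathcomp Require Import all_boot all_order all_algebra.
From mathcomp Require Import all_classical all_reals all_analysis.

Set Implicit Arguments.
Unset Strict Implicit.
Unset Printing Implicit Defensive.

Import Order.TTheory GRing.Theory Num.Theory.
Import numFieldNormedType.Exports.

Local Open Scope classical_set_scope.
Local Open Scope ring_scope.

Notation borel T := (g_sigma_algebraType (@open T%type)).

(* The library's norm on 'rV[R]_n is the sup norm; it induces the same topology
   as [eucl_dist]. *)
Definition eucl_dist {R : realType} {n : nat} (x y : 'rV[R]_n) : R :=
  Num.sqrt (\sum_(i < n) (x ord0 i - y ord0 i) ^+ 2).

Notation borel_measure T R := {measure set (borel T) -> \bar R}.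

Section boundary_wasserstein.
Context {R : realType} {n : nat}.
Let X := 'rV[R]_n.
Implicit Types (Omega : set X) (mu nu : borel_measure X R).

(* A measure on the open set Omega is represented by a measure on R^n of which
   only the values on the Borel subsets of Omega are used. *)
Definition eq_restr Omega (mu nu : set (borel X) -> \bar R) :=
  forall A : set (borel X), measurable A -> A `<=` Omega -> mu A = nu A.

Definition coupling Omega mu nu : set (borel_measure (X * X) R) :=
  [set gamma |
    eq_restr Omega
      (pushforward gamma (fst : borel (X * X) -> borel X)) mu /\
    eq_restr Omega
      (pushforward gamma (snd : borel (X * X) -> borel X)) nu].

Definition Wb2 Omega mu nu : \bar R :=
  ereal_inf [set sqrte (\int[gamma]_z (eucl_dist z.1 z.2 ^+ 2)%:E)%E
            | gamma in coupling Omega mu nu].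

(* The equality is between functions on all subsets of R^n, not only on Borel
   sets, so that a sum of Dirac masses is a single element. *)
Definition Bm Omega (m : nat) : set (borel_measure X R) :=
  \bigcup_(k in [set k | (1 <= k <= m)%N])
    [set mu | exists2 x : 'I_k -> borel X, (forall i, Omega (x i)) &
      mu = (fun A => \sum_(i < k) \d_(x i) A)%E :> (set (borel X) -> \bar R)].

End boundary_wasserstein.

(* Functions on nat that are square-integrable for the counting measure; the
   null sets are empty, so no quotient is needed. *)
Definition ell2 (R : realType) :=
  LfunType (@counting nat R : {measure set nat -> \bar R}) (lee1n 2).

Definition ell2_dist {R : realType} (u v : ell2 R) : \bar R :=
  ('N[@counting nat R]_2[EFin \o (u - v)%R])%E.

Section distortion.
Context {R : realType}.

(* Distances are extended real-valued functions; the infimum is +oo when no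
   Lipschitz constant exists. *)
Definition Lip {S T : Type} (A : set S) (dS : S -> S -> \bar R)
    (dT : T -> T -> \bar R) (f : S -> T) : \bar R :=
  ereal_inf [set L%:E | L in [set L : R | 0 <= L /\
    forall x y, A x -> A y -> (dT (f x) (f y) <= L%:E * dS x y)%E]].

(* The default value [s0] of the partial inverse is never used on [f @` A]. *)
Definition distortion {S T : Type} (A : set S)
    (dS : S -> S -> \bar R) (dT : T -> T -> \bar R) (s0 : S) (f : S -> T) :
    \bar R :=
  (Lip A dS dT f * Lip (f @` A) dT dS ('pinv_(fun=> s0) A f))%E.

Definition bilipschitz {S T : Type} (A : set S)
    (dS : S -> S -> \bar R) (dT : T -> T -> \bar R) (s0 : S) (f : S -> T) :=
  {in A &, injective f} /\ (distortion A dS dT s0 f < +oo)%E.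

End distortion.

(* Main.v *)
(* Let rho be the distance to the complement of Omega.  Tents on a Whitney-type
   family of dyadic nodes give functions phi_j that are 1-Lipschitz, vanish
   outside Omega, are nonzero at a given point for at most N(n) indices, and
   separate x from y by a multiple of min(|x - y|, max(rho x, rho y)).

   Draw letters a_j uniformly from {0, ..., K} with K = 2 m^2 and let f be the
   sum of the a_j phi_j.  For given x, y the difference f(x) - f(y) is small
   with probability at most 1/(K+1), so for two m-point configurations f
   separates all m^2 pairs with probability at least 1/2.  Then sorting the
   values of f produces a matching that bounds Wb_2 from above.  Conversely
   every order statistic of f is Lipschitz for Wb_2: if the i-th values a > b of
   two configurations differ, every coupling moves a mass at least 1 from
   {f >= a} to {f <= b}.  The embedding is the L^2 function sending the letters
   to the order statistics.  For a given configuration it depends on finitely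
   many letters, so its martingale differences form a finitely supported
   sequence, with the same norm.  This yields distortion O(m^(5/2)). *)

Require Import Defs.
From HB Require Import structures.
From mathcomp Require Import all_boot all_order all_algebra.
From mathcomp Require Import all_classical all_reals all_analysis.
From mathcomp Require Import measurable_realfun ring lra zify.

Set Implicit Arguments.
Unset Strict Implicit.
Unset Printing Implicit Defensive.

Import Order.TTheory GRing.Theory Num.Theory.
Import numFieldNormedType.Exports.

Local Open Scope classical_set_scope.
Local Open Scope ring_scope.

(** * Averages over words and martingale differences *)

Section averages.
Context {R : realType} (K : nat).
Implicit Types (h g : seq 'I_K.+1 -> R) (w : seq 'I_K.+1) (d T N : nat).

(* Words list the latest letter first, so [avg d h w] is the conditional
   expectation, given the first [size w] letters, of [h] after [d] more draws.
     *)
Fixpoint avg d h w : R :=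
  if d is d'.+1 then K.+1%:R^-1 * \sum_(a < K.+1) avg d' h (a :: w) else h w.

Lemma avg_le d h g w : (forall v, h v <= g v) -> avg d h w <= avg d g w.
Proof.
move=> hg; elim: d w => [|d IHd] w //=.
by rewrite ler_wpM2l ?invr_ge0 ?ler0n//; apply: ler_sum => a _; exact: IHd.
Qed.

Lemma avg_cst d (c : R) w : avg d (fun=> c) w = c.
Proof.
elim: d w => [//|d IHd] w /=; under eq_bigr do rewrite IHd.
by rewrite sumr_const card_ord -(mulr_natl c) mulKf ?pnatr_eq0.
Qed.

Lemma avgZ d (c : R) h w : avg d (fun v => c * h v) w = c * avg d h w.
Proof.
elim: d w => [//|d IHd] w /=; under eq_bigr do rewrite IHd.
by rewrite -mulr_sumr mulrCA.
Qed.

Lemma avg_sum d (I : Type) (r : seq I) (H : I -> seq 'I_K.+1 -> R) w :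
  avg d (fun v => \sum_(i <- r) H i v) w = \sum_(i <- r) avg d (H i) w.
Proof.
elim: d w => [//|d IHd] w /=; under eq_bigr do rewrite IHd.
by rewrite exchange_big /= mulr_sumr.
Qed.

Lemma avgB d h g w : avg d (fun v => h v - g v) w = avg d h w - avg d g w.
Proof.
elim: d w => [//|d IHd] w /=; under eq_bigr do rewrite IHd.
by rewrite sumrB mulrBr.
Qed.

(** The head of a word is its latest letter, so such an [h] depends on the first [T] letters
    only. *)
Definition stable T h := forall a w, (T <= size w)%N -> h (a :: w) = h w.

Lemma avg_stable T h d w : stable T h -> (T <= d + size w)%N ->
  avg d h w = avg (T - size w) h w.
Proof.
move=> sh; have st e v : (T <= size v)%N -> avg e h v = h v.
  elim: e v => [//|e IHe] v Tv /=; under eq_bigr => a _ do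
    rewrite IHe ?sh//= 1?leqW//.
  by rewrite sumr_const card_ord -(mulr_natl (h v)) mulKf ?pnatr_eq0.
elim: d w => [|d IHd] w; first by rewrite add0n => Tw; rewrite !st.
have [Tw _|wT] := leqP T (size w); first by rewrite !st.
rewrite addSnnS => Tdw; rewrite (_ : T - size w = (T - (size w).+1).+1)%N;
  last by lia.
rewrite /=; congr (_ * _); apply: eq_bigr => a _; rewrite IHd //.
Qed.

Fixpoint words N : seq (seq 'I_K.+1) :=
  if N is N'.+1 then [seq a :: w | a <- enum 'I_K.+1, w <- words N'] else [::
    [::]].

Lemma mem_words N w : (w \in words N) = (size w == N).
Proof.
elim: N w => [|N IHN] w; first by rewrite inE; case: w.
case: w => [|a w] /=.
  by apply/negP => /allpairsP[[b v] /= [_ _]].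
rewrite eqSS -IHN; apply/allpairsP/idP => [[[b v] /= [_ vN [_ ->]]]//|wN].
by exists (a, w); rewrite /= mem_enum.
Qed.

Lemma uniq_words N : uniq (words N).
Proof.
elim: N => [//|N IHN] /=; apply: allpairs_uniq; rewrite ?enum_uniq//.
by move=> [a w] [b v] _ _ /= [-> ->].
Qed.

Lemma sum_words_cons N (F : seq 'I_K.+1 -> R) :
  \sum_(w <- words N.+1) F w = \sum_(w <- words N) \sum_(a < K.+1) F (a :: w).
Proof. by rewrite /= big_allpairs_dep exchange_big /=; apply: eq_bigr => w _;
  rewrite big_enum. Qed.

Lemma avg_words T N h : (N <= T)%N ->
  avg T h [::] = K.+1%:R ^- N * \sum_(w <- words N) avg (T - N) h w.
Proof.
elim: N => [_|N IHN NT]; first by rewrite expr0 invr1 mul1r big_seq1 subn0.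
rewrite IHN 1?ltnW// sum_words_cons (_ : T - N = (T - N.+1).+1)%N; last by lia.
by rewrite /= -mulr_sumr mulrA exprSr invfM.
Qed.

(** The increment, at the latest letter of [w], of the martingale of conditional expectations,
    weighted by the square root of the probability of [w]. With this weight plain sums of squares
    over words are expectations. The empty word carries the mean. *)
Definition mart T h w : R :=
  if w is a :: v then
    Num.sqrt K.+1%:R ^- size w
      * (avg (T - size w) h w - avg (T - size v) h v)
  else avg T h [::].

(** Draws after the first [T] change no conditional expectation. Configurations with different
    horizons can therefore be compared at a common one. *)
Lemma mart_stable T T' h : stable T h -> (T <= T')%N -> mart T' h = mart T h.
Proof.
move=> sh TT'; apply/funext => -[|a v] /=.
  by rewrite (avg_stable sh) ?subn0// addn0.
rewrite (avg_stable sh (d := T' - (size v).+1)) /=; last by lia.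
by rewrite (avg_stable sh (d := T' - size v)) //; lia.
Qed.

Lemma mart_eq0 T h w : stable T h -> (T < size w)%N -> mart T h w = 0.
Proof.
move=> sh; case: w => //= a v; rewrite ltnS => Tv.
have -> : (T - (size v).+1 = 0)%N by lia.
have -> : (T - size v = 0)%N by lia.
by rewrite /= sh// subrr mulr0.
Qed.

Lemma martB T h g w : mart T (fun v => h v - g v) w = mart T h w - mart T g w.
Proof.
case: w => [|a v]; first exact: avgB.
by rewrite /mart !avgB -mulrBr; congr (_ * _); ring.
Qed.

(** The second moment is the squared mean plus the variance, here weighted by the probability of a
    word of length [N] to serve as one step of [mart_parseval]. *)
Lemma mean_variance N (A : 'I_K.+1 -> R) :
  K.+1%:R ^- N * (K.+1%:R^-1 * \sum_a A a) ^+ 2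
    + K.+1%:R ^- N.+1 * \sum_a (A a - K.+1%:R^-1 * \sum_b A b) ^+ 2
  = K.+1%:R ^- N.+1 * \sum_a A a ^+ 2.
Proof.
set k := K.+1%:R; have k0 : k != 0 :> R by rewrite pnatr_eq0.
set s := \sum_b A b.
have -> : \sum_a (A a - k^-1 * s) ^+ 2 = \sum_a A a ^+ 2 - k^-1 * s ^+ 2.
  under eq_bigr do rewrite sqrrB.
  rewrite big_split /= sumr_const card_ord sumrB sumrMnl -mulr_suml -/s.
  rewrite -[X in _ + X = _]mulr_natl -/k -mulr_natl; clearbody k s; by field.
rewrite (exprSr k N); have := expf_neq0 N k0.
by move: (k ^+ N) => kN kN0; clearbody k s; field; rewrite ?k0 ?kN0.
Qed.

(* Orthogonality of martingale differences. *)
Lemma mart_parseval T h :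
  \sum_(w <- flatten [seq words j | j <- iota 0 T.+1]) mart T h w ^+ 2
    = avg T (fun w => h w ^+ 2) [::].
Proof.
rewrite big_flatten big_map.
(* The words of length at most [N] account for the second moment of the conditional expectation
   given the first [N] letters. *)
have step N : (N <= T)%N ->
    \sum_(j <- iota 0 N.+1) \sum_(w <- words j) mart T h w ^+ 2
      = K.+1%:R ^- N * \sum_(w <- words N) avg (T - N) h w ^+ 2.
  elim: N => [_|N IHN NT]; first by rewrite !big_seq1 expr0 invr1 mul1r subn0.
  rewrite -[N.+2]addn1 iotaD big_cat /= IHN 1?ltnW// add0n big_seq1.
  rewrite !sum_words_cons !mulr_sumr -big_split /=.
  apply: eq_big_seq => w; rewrite mem_words => /eqP wN; rewrite wN.
  rewrite [X in avg X h w](_ : T - N = (T - N.+1).+1)%N; last by lia.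
  under [X in _ + X]eq_bigr => a _ do
    rewrite exprMn exprVn -exprM mulnC exprM sqr_sqrtr ?ler0n//.
  by rewrite -mulr_sumr /=;
    exact: (mean_variance N (fun a => avg _ h (a :: w))).
rewrite step// subnn /= (avg_words _ (leqnn T)) subnn /=; reflexivity.
Qed.

End averages.

(** * Finitely supported families as elements of the sequence space *)

Section square_summable.
Context {R : realType}.

Lemma nneseries_finite_support (a : nat -> \bar R) (l : seq nat) : uniq l ->
  (forall k, k \notin l -> a k = 0%E) ->
  (\sum_(k <oo) a k = \sum_(k <- l) a k)%E.
Proof.
move=> ul a0; pose N := (\max_(k <- l) k.+1)%N.
have lN k : k \in l -> (k < N)%N by move=> kl; exact: (leq_bigmax_seq _ kl).
have NE M : (N <= M)%N -> (\sum_(0 <= k < M) a k = \sum_(k <- l) a k)%E.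
  move=> NM; rewrite (bigID (mem l)) /= [X in (_ + X)%E]big1// adde0.
  rewrite -big_filter; apply/perm_big/uniq_perm => //.
    by rewrite filter_uniq// iota_uniq.
  move=> k; rewrite mem_filter mem_index_iota /= andb_idr// => /lN kN.
  exact: leq_trans kN NM.
apply: (@lim_near_cst (\bar R)); first exact: ereal_hausdorff.
by exists N => // M /= NM; exact: NE.
Qed.

Variable I : countType.

(** [pickle_inv] is defined on codes only, so each index occupies exactly one position and no
    coefficient is repeated. *)
Definition lift_nat (c : I -> R) (q : nat) : R :=
  if pickle_inv q is Some i then c i else 0.

Lemma Lnorm2_lift_nat (c : I -> R) (l : seq I) : uniq l ->
  (forall i, i \notin l -> c i = 0) ->
  ('N[@counting nat R]_2[EFin \o lift_nat c]
    = (Num.sqrt (\sum_(i <- l) c i ^+ 2))%:E)%E.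
Proof.
move=> ul c0; rewrite Lnorm_counting//.
rewrite (@nneseries_finite_support _ (map pickle l)).
- rewrite big_map; under eq_bigr => i _ do
    rewrite /= /lift_nat pickleK_inv powR_mulrn// real_normK ?num_real//.
  by rewrite sumEFin poweR12_sqrt// lee_fin sumr_ge0// => i _; exact: sqr_ge0.
- by rewrite map_inj_uniq//; exact: (pcan_inj pickleK_inv).
- move=> q ql; rewrite /= /lift_nat.
  case: (pickle_inv q) (@pickle_invK I q) => [i /= iq|_];
    last by rewrite normr0 powR0.
  by rewrite c0 ?normr0 ?powR0//; apply: contra ql => il; rewrite -iq map_f.
Qed.

Lemma ell2_lift (c : I -> R) (l : seq I) : uniq l ->
  (forall i, i \notin l -> c i = 0) ->
  exists u : ell2 R, u = lift_nat c :> (nat -> R).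
Proof.
move=> ul c0.
have cL : lift_nat c \in Lfun (@counting nat R) 2%:E.
  rewrite inE; apply/andP; split; rewrite inE//=.
  by rewrite /finite_norm (Lnorm2_lift_nat ul c0) ltry.
by exists (Lfun_Sub (lee1n 2) cL).
Qed.

Lemma ell2_dist_lift (c c' : I -> R) (u u' : ell2 R) (l : seq I) :
  u = lift_nat c :> (nat -> R) -> u' = lift_nat c' :> (nat -> R) -> uniq l ->
  (forall i, i \notin l -> c i = c' i) ->
  ell2_dist u u' = (Num.sqrt (\sum_(i <- l) (c i - c' i) ^+ 2))%:E.
Proof.
move=> uc uc' ul cc'; rewrite /ell2_dist.
rewrite -(@Lnorm2_lift_nat (fun i => c i - c' i))//; last first.
  by move=> i /cc' ->; rewrite subrr.
apply: eq_Lnorm => q /=; congr EFin.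
rewrite [LHS](_ : _ = u q - u' q)// uc uc' /lift_nat.
by case: pickle_inv => //; rewrite subrr.
Qed.

End square_summable.

(** * Random combinations *)

Section random_combinations.
Context {R : realType} {X : eqType} (K : nat) (phi : nat -> X -> R).
Implicit Types (w : seq 'I_K.+1) (x y : X) (d T : nat).

(** The letter drawn after [j] others sits on a tail of size [j] and is the coefficient of
    [phi j]. *)
Fixpoint comb w x : R :=
  if w is a :: v then a%:R * phi (size v) x + comb v x else 0.

Lemma comb_ge0 w x : (forall j, 0 <= phi j x) -> 0 <= comb w x.
Proof.
by move=> p0; elim: w => [//|a w IHw] /=; rewrite addr_ge0// mulr_ge0// ler0n.
Qed.

Lemma comb_eq0 w x : (forall j, phi j x = 0) -> comb w x = 0.
Proof. by move=> p0; elim: w => [//|a w IHw] /=;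
  rewrite p0 mulr0 IHw addr0. Qed.

Lemma comb_cons_stable T a w x : (forall j, (T <= j)%N -> phi j x = 0) ->
  (T <= size w)%N -> comb (a :: w) x = comb w x.
Proof. by move=> pT Tw /=; rewrite pT// mulr0 add0r. Qed.

Lemma comb_lipschitz w x y :
  `|comb w x - comb w y| <= K%:R * \sum_(j < size w) `|phi j x - phi j y|.
Proof.
elim: w => [|a w IHw] /=; first by rewrite subrr normr0 big_ord0 mulr0.
rewrite [X in `|X|](_ : _ = (comb w x - comb w y)
  + a%:R * (phi (size w) x - phi (size w) y)); last by ring.
rewrite big_ord_recr /= [leRHS]mulrDr (le_trans (ler_normD _ _))// lerD//
  normrM normr_nat ler_wpM2r//.
by rewrite ler_nat -ltnS.
Qed.

Let near (b : R) x y w : R := (`|comb w x - comb w y| < b)%R%:R.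

(** Among reals that are [2 * b] apart at most one has absolute value below [b], and common further
    draws preserve the separation. *)
Lemma sum_near_le1 (b : R) x y N d (W : 'I_K.+1 -> seq 'I_K.+1) :
  (forall a, size (W a) = N) ->
  (forall a a', a != a' -> 2 * b <=
    `|(comb (W a) x - comb (W a) y) - (comb (W a') x - comb (W a') y)|) ->
  \sum_a avg d (near b x y) (W a) <= 1.
Proof.
elim: d N W => [|d IHd] N W WN sep /=.
  have [/existsP[a na]|/existsPn no] :=
      boolP [exists a, `|comb (W a) x - comb (W a) y| < b].
    rewrite (bigD1 a)//= big1 ?addr0 ?/near ?na// => a' a'a; rewrite /near.
    suff /negbTE -> : ~~ (`|comb (W a') x - comb (W a') y| < b) by [].
    rewrite -leNgt; have := sep _ _ a'a.
    have := ler_normB (comb (W a') x - comb (W a') y)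
      (comb (W a) x - comb (W a) y).
    lra.
  by rewrite big1// => a _; rewrite /near (negbTE (no a)).
rewrite -mulr_sumr exchange_big /= mulrC ler_pdivrMr ?ltr0n// mul1r.
rewrite [leRHS](_ : _ = \sum_(c < K.+1) 1); last by rewrite sumr_const card_ord.
(* All words receive the same letter [c]; as their sizes agree, it adds the same term to every
   difference. *)
apply: ler_sum => c _; apply: (IHd N.+1) => [a|a a' aa'] /=;
  first by rewrite WN.
by rewrite !WN (le_trans (sep _ _ aa'))// le_eqVlt; apply/orP; left; apply/eqP;
  congr `|_|; ring.
Qed.

(* Once the other letters are fixed, the values for the j-th letter are
   2b-separated, hence at most one of them falls in the ball. *)
Lemma avg_near (b : R) x y j d w : 2 * b <= `|phi j x - phi j y| ->
  (size w <= j < size w + d)%N -> avg d (near b x y) w <= K.+1%:R^-1.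
Proof.
move=> bj; elim: d w => [|d IHd] w; first by rewrite addn0; lia.
move=> jw /=; have [wj|wj] := ltnP (size w) j.
  rewrite ler_piMr ?invr_ge0 ?ler0n//.
  rewrite (le_trans (y := \sum_(a < K.+1) K.+1%:R^-1))//.
    by apply: ler_sum => a _; apply: IHd => /=; lia.
  by rewrite sumr_const card_ord -(mulr_natl (_^-1)) mulfV// pnatr_eq0.
(* Now the next letter is the [j]-th, and the words [a :: w] differ in the coefficient of [phi j]
   alone. *)
rewrite ler_piMr ?invr_ge0 ?ler0n//;
  apply: (@sum_near_le1 _ _ _ (size w).+1) => //=.
move=> a a' aa'; have -> : size w = j by lia.
rewrite [X in `|X|](_ : _ = (a%:R - a'%:R) * (phi j x - phi j y)); last by ring.
rewrite normrM (le_trans bj)// ler_peMl//.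
have : (1 <= `|a%:Z - a'%:Z|)%R.
  rewrite -gtz0_ge1 normr_gt0 subr_eq0; apply: contra aa' => /eqP[aa'].
  exact/eqP/val_inj.
by rewrite -(ler_int R) intr_norm intrB.
Qed.

(** A union bound: each pair of [r] is badly separated with probability at most [K.+1%:R^-1], hence
    some pair is with probability at most one half. *)
Lemma avg_ge_half T (r : seq (X * X)) (b : X * X -> R) (c : R) G :
  ((size r).*2 <= K.+1)%N -> 0 <= c -> (forall w, 0 <= G w) ->
  (forall p, p \in r ->
    exists2 j, (j < T)%N & 2 * b p <= `|phi j p.1 - phi j p.2|) ->
  (forall w, (forall p, p \in r -> b p <= `|comb w p.1 - comb w p.2|) ->
    c <= G w) ->
  c / 2 <= avg T G [::].
Proof.
move=> rK c0 G0 far cG.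
(* [G] dominates [c] times one minus the number of bad pairs, which is at most 0 as soon as one pair
   is bad. *)
apply: (le_trans (y := avg T (fun w =>
    c - c * \sum_(p <- r) near (b p) p.1 p.2 w) [::])); last first.
  apply: avg_le => w; have [good|] := boolP
      (all (fun p => b p <= `|comb w p.1 - comb w p.2|) r).
    rewrite (le_trans (y := c))//; last by apply: cG; exact/allP.
    by rewrite gerBl mulr_ge0// sumr_ge0// => p _; rewrite ler0n.
  move=> /allPn[p pr]; rewrite -ltNge => pb; apply: le_trans (G0 w).
  rewrite subr_le0 ler_peMr// (big_rem p)//= /near pb.
  by rewrite lerDl sumr_ge0// => q _; rewrite ler0n.
rewrite avgB avg_cst avgZ avg_sum.
rewrite (_ : c / 2 = c - c * 2^-1); last by field.
rewrite lerB// ler_wpM2l//.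
rewrite (le_trans (y := \sum_(p <- r) K.+1%:R^-1))//.
  rewrite big_seq [leRHS]big_seq; apply: ler_sum => p /far[j jT bj].
  by apply: (avg_near bj); rewrite /= add0n.
rewrite big_const_seq count_predT iter_addr addr0 -(mulr_natl (_^-1)).
rewrite ler_pdivrMr ?ltr0n// mulrC ler_pdivlMr// -natrM ler_nat.
by rewrite muln2.
Qed.

End random_combinations.

(** * Whitney tents *)

Section sup_norm.
Context {R : realType} {n : nat}.
Implicit Types v : 'rV[R]_n.

Lemma normr_coord v j : `|v ord0 j| <= `|v|.
Proof.
rewrite [leRHS]mx_normrE.
exact: (le_bigmax _ (fun ij : 'I_1 * 'I_n => `|v ij.1 ij.2|) (ord0, j)).
Qed.

Lemma normr_coord_le v (c : R) : 0 <= c -> (forall j, `|v ord0 j| <= c) ->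
  `|v| <= c.
Proof.
by move=> c0 vc; rewrite [leLHS]mx_normrE; apply: bigmax_le => // -[i j] _;
  rewrite (ord1 i).
Qed.

Lemma normr_coord_attained v : v != 0 -> exists j, `|v| = `|v ord0 j|.
Proof.
rewrite -normr_eq0 => /mx_norm_neq0[[i j] /= vE].
by exists j; rewrite (ord1 i) in vE; exact: vE.
Qed.

End sup_norm.

Lemma exists_dyadic {R : realType} (r : R) : 0 < r ->
  exists k : int, 2 ^ k <= r < 2 ^ (k + 1).
Proof.
(* Multiplying by [2 ^+ M] brings [r] to at least 1, so the search for an exponent can run over the
   natural numbers. *)
move=> r0; pose M := Num.bound r^-1.
have rM : 1 <= r * 2 ^+ M.
  by rewrite mulrC -ler_pdivrMr// mul1r ltW// upper_nthrootP.
have ex : exists i, r * 2 ^+ M < 2 ^+ i.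
  by exists (Num.bound (r * 2 ^+ M)); rewrite upper_nthrootP.
case: (ex_minnP ex) => -[|i] ri imin; first by move: ri; rewrite expr0 ltNge rM.
exists (i%:Z - M%:Z); have M0 : 0 < 2 ^+ M :> R by rewrite exprn_gt0.
have -> : (2 : R) ^ (i%:Z - M%:Z) = 2 ^+ i / 2 ^+ M.
  by rewrite expfzDr// -exprnN -exprnP.
have -> : (2 : R) ^ (i%:Z - M%:Z + 1) = 2 ^+ i.+1 / 2 ^+ M.
  rewrite (_ : i%:Z - M%:Z + 1 = i.+1%:Z - M%:Z); last by lia.
  by rewrite expfzDr// -exprnN -exprnP.
rewrite ler_pdivrMr// ltr_pdivlMr// ri andbT leNgt; apply/negP => /imin.
by rewrite ltnn.
Qed.

Section whitney_tents.
Context {R : realType} (n : nat) (Omega : set 'rV[R]_n).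
Hypotheses (oO : open Omega) (OT : Omega <> setT).
Implicit Types x y : 'rV[R]_n.

Definition rho x : R := inf [set `|x - z| | z in ~` Omega].

Let dist_nonempty x : [set `|x - z| | z in ~` Omega] !=set0.
Proof.
apply: contrapT => /set0P/negP/negPn/eqP xO; apply: OT; rewrite -subTset => z _.
apply: contrapT => Oz; have : [set `|x - z| | z in ~` Omega] (`|x - z|) by
  exists z.
by rewrite xO.
Qed.

Let dist_lbound x : lbound [set `|x - z| | z in ~` Omega] 0.
Proof. by move=> _ [z _ <-]. Qed.

Lemma rho_ge0 x : 0 <= rho x.
Proof. exact: lb_le_inf. Qed.

Lemma rho_le x z : ~ Omega z -> rho x <= `|x - z|.
Proof. by move=> Oz; apply: ge_inf; [exists 0;
  exact: dist_lbound|exists z]. Qed.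

Lemma rho_lipschitz x y : rho x <= `|x - y| + rho y.
Proof.
rewrite -lerBlDl; apply: lb_le_inf => // _ [z Oz <-].
by rewrite lerBlDl (le_trans (rho_le _ Oz))// -(subrKA y) ler_normD.
Qed.

Lemma rho_out x : ~ Omega x -> rho x = 0.
Proof. by move=> /(rho_le x); rewrite subrr normr0 => rx; apply/eqP;
  rewrite eq_le rx rho_ge0. Qed.

Lemma rho_gt0 x : Omega x -> 0 < rho x.
Proof.
move=> /oO; rewrite /= -nbhs_ballE => -[e /= e0 xe].
apply: (lt_le_trans e0); apply: lb_le_inf => // _ [z Oz <-].
rewrite leNgt; apply/negP => xz; apply/Oz/xe.
by rewrite -ball_normE.
Qed.

(** The factor 2 leaves room for an approximate minimiser of the infimum. *)
Lemma exists_near_boundary x : exists2 b, ~ Omega b & `|x - b| <= 2 * rho x.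
Proof.
have [/rho_gt0 x0|Ox] := pselect (Omega x); last first.
  by exists x => //; rewrite subrr normr0 mulr_ge0// rho_ge0.
have [|_ [b Ob <-] xb] := @inf_adherent _ [set `|x - z| | z in ~` Omega] _ x0.
  by split=> //; exists 0; exact: dist_lbound.
by exists b => //; rewrite (le_trans (ltW xb))// -/(rho x) mulr_natl mulr2n.
Qed.

Implicit Types (k : int) (p : 'rV[int]_n).

Definition node k p : 'rV[R]_n := \row_j (2 ^ k * (p ord0 j)%:~R).

(* The tent of radius [4 * 2^k] at a node is used only if the node is at
   distance comparable to [2^k] from the complement of Omega. *)
Definition tent k p x : R :=
  if 5 * 2 ^ k <= rho (node k p) <= 19 * 2 ^ k
  then Num.max 0 (4 * 2 ^ k - `|x - node k p|) else 0.

Let pow2_gt0 k : 0 < 2 ^ k :> R. Proof. exact: exprz_gt0. Qed.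

Lemma tent_ge0 k p x : 0 <= tent k p x.
Proof. by rewrite /tent; case: ifP => // _; rewrite le_max lexx. Qed.

(** Since [rho] is 1-Lipschitz and the support has radius [4 * 2 ^ k], the bounds 5 and 19 at the
    node become 5 - 4 = 1 and 19 + 4 = 23. *)
Lemma tent_active k p x : tent k p x != 0 ->
  [/\ 2 ^ k <= rho x, rho x <= 23 * 2 ^ k & `|x - node k p| < 4 * 2 ^ k].
Proof.
rewrite /tent; case: ifPn => [/andP[r5 r19]|]; last by rewrite eqxx.
have := rho_lipschitz x (node k p); have := rho_lipschitz (node k p) x.
rewrite (distrC (node k p)); have := pow2_gt0 k => ? ? ?.
have [? _|_] := ltP 0 (4 * 2 ^ k - `|x - node k p|); last by rewrite eqxx.
by split; lra.
Qed.

Lemma tent_out k p x : ~ Omega x -> tent k p x = 0.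
Proof.
move=> Ox; apply: contrapT => /eqP/tent_active[+ _ _].
by rewrite rho_out// leNgt pow2_gt0.
Qed.

Lemma tent_lipschitz k p x y : `|tent k p x - tent k p y| <= `|x - y|.
Proof.
rewrite /tent; case: ifP => _; last by rewrite subrr normr0.
have := ler_distD x y (node k p); have := ler_distD y x (node k p).
rewrite (distrC y x) => + +;
  move: `|x - node k p| `|y - node k p| `|x - y| => a b c ac bc.
rewrite ler_norml; have [?|?] := leP 0 (4 * 2 ^ k - a);
by have [?|?] := leP 0 (4 * 2 ^ k - b); apply/andP; split; lra.
Qed.

Let residue N (z : int) : 'I_N.+1 := inord `|(z %% N.+1)%Z|%N.

Let residue_inj N (z z' : int) :
  residue N z = residue N z' -> `|z - z'| < N.+1 -> z = z'.
Proof.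
have absM a : `|(a %% N.+1)%Z|%N%:Z = (a %% N.+1)%Z.
  by rewrite gez0_abs// modz_ge0.
have ltM a : (`|(a %% N.+1)%Z| < N.+1)%N by rewrite -ltz_nat absM ltz_pmod.
move=> /(congr1 (fun i : 'I_N.+1 => (i : nat)%:Z)); rewrite /= !inordK// !absM.
move=> zz'; rewrite [z in `|z - _|](divz_eq z N.+1) [z' in `|_ - z'|](divz_eq
  z' N.+1).
rewrite zz' opprD addrACA subrr addr0 -mulrBl normrM => lt1.
rewrite (divz_eq z N.+1) (divz_eq z' N.+1) zz'; congr (_ * _ + _).
apply/eqP; rewrite -subr_eq0 -normr_eq0; move: lt1; set t := `|_|.
have : 0 <= t by rewrite normr_ge0.
by rewrite (ger0_norm (_ : 0 <= N.+1%:Z))//; move: t => t t0 tN; nia.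
Qed.

Let code (kp : int * 'rV[int]_n) : 'I_5 * {ffun 'I_n -> 'I_8} :=
  (residue 4 kp.1, [ffun j => residue 7 (kp.2 ord0 j)]).

(** Bounded overlap by colouring. Two scales active at [x] have ratio at most 23 < 2 ^ 5, so they
    are determined modulo 5. Two active nodes of one scale are less than [8 * 2 ^ k] apart, so their
    integer coordinates are determined modulo 8. *)
Let code_inj x kp kp' : tent kp.1 kp.2 x != 0 -> tent kp'.1 kp'.2 x != 0 ->
  code kp = code kp' -> kp = kp'.
Proof.
move: kp kp' => [k p] [k' p'] /= /tent_active[kx xk xp] /tent_active[k'x xk'
  xp'].
case=> /residue_inj ck /ffunP cp.
have lt5 (a b : int) : 2 ^ a <= rho x -> rho x <= 23 * 2 ^ b -> a - b < 5.
  move=> ax xb; suff : (2 : R) ^ (a - b) < 2 ^ 5 by rewrite ltr_eXz2l// ltr1n.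
  rewrite expfzDr// -invr_expz (lt_trans (y := 24))//.
    by rewrite ltr_pdivrMr ?pow2_gt0// (le_lt_trans (le_trans ax xb))//
      ltr_pM2r ?pow2_gt0// ltr_nat.
  by rewrite -exprnP -natrX ltr_nat.
have kk' : k = k'.
  by apply: ck; have := lt5 _ _ kx xk'; have := lt5 _ _ k'x xk; lia.
subst k'; congr pair; apply/rowP => j; apply: (@residue_inj 7).
  by have := cp j; rewrite !ffunE.
have : `|node k p - node k p'| < 8 * 2 ^ k.
  by have := ler_distD x (node k p) (node k p'); rewrite (distrC _ x); lra.
move=> /(le_lt_trans (normr_coord _ j)); rewrite !mxE -mulrBr normrM.
rewrite gtr0_norm ?pow2_gt0// mulrC ltr_pM2r ?pow2_gt0//.
by rewrite -intrB -intr_norm -(ltr_int R).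
Qed.

(** The grid point is taken on the side of [a] away from [b], which makes the distances add up. *)
Lemma exists_node_coord (a b u : R) : 0 < u -> exists q : int,
  2 * u <= `|a - u * q%:~R| <= 3 * u /\
  `|b - u * q%:~R| = `|a - b| + `|a - u * q%:~R|.
Proof.
move=> u0; have /andP := floor_itv (a / u).
rewrite ler_pdivlMr// ltr_pdivrMr// intrD mulrDl mul1r mulrC => -[fa af].
have [ba|ab] := leP b a.
  exists (Num.floor (a / u) + 3); rewrite intrD mulrDr.
  rewrite (ger0_norm (_ : 0 <= a - b)) ?subr_ge0//.
  rewrite !ler0_norm; lra.
exists (Num.floor (a / u) - 2); rewrite intrB mulrBr.
rewrite (ltr0_norm (_ : a - b < 0)) ?subr_lt0//.
rewrite !ger0_norm; lra.
Qed.

(** With u = [2 ^ k] of order [rho x], the node is placed beyond [x] as seen from [y], in a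
    coordinate that realises [|x - y|]. The tent then descends at full slope from [x] towards [y],
    by at least the minimum of [|x - y|] and u, and [rho x] is less than 16 u. *)
Lemma exists_separating_tent x y : exists k p,
  Num.min `|x - y| (rho x) <= 16 * `|tent k p x - tent k p y|.
Proof.
have [xy|xy] := eqVneq x y.
  by exists 0, 0; rewrite xy !subrr !normr0 mulr0 ge_min lexx.
have [x0|x0] := leP (rho x) 0.
  by exists 0, 0; rewrite ge_min (le_trans x0) ?orbT// mulr_ge0.
have [k /andP[kx xk]] : exists k : int, 2 ^ k <= rho x / 8 < 2 ^ (k + 1).
  by apply: exists_dyadic; rewrite divr_gt0.
rewrite ler_pdivlMr// in kx; rewrite ltr_pdivrMr// expfzDr// expr1z in xk.
have [i xyi] : exists i, `|x - y| = `|(x - y) ord0 i|.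
  by apply: normr_coord_attained; rewrite subr_eq0.
have u0 := pow2_gt0 k; set u : R := 2 ^ k in kx xk u0 *.
have [q [/andP[q2 q3] yq]] := exists_node_coord (x ord0 i) (y ord0 i) u0.
pose p : 'rV[int]_n :=
  \row_j if j == i then q else Num.floor (x ord0 j / u).
(* In the other coordinates the node is within [u] of [x], so coordinate [i], with offset at least
   [2 * u], gives the sup norm. *)
have xp : `|x - node k p| = `|x ord0 i - u * q%:~R|.
  apply/eqP; rewrite eq_le; apply/andP; split; last first.
    by have := normr_coord (x - node k p) i; rewrite !mxE eqxx.
  apply: normr_coord_le => // j; rewrite !mxE; case: eqVneq => [->//|_].
  have /andP := floor_itv (x ord0 j / u).
  rewrite ler_pdivlMr// ltr_pdivrMr// intrD mulrDl mul1r mulrC -/u => -[fa af].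
  by rewrite ger0_norm; lra.
have yp : `|x - y| + `|x - node k p| <= `|y - node k p|.
  rewrite xp xyi; have := normr_coord (y - node k p) i.
  by rewrite !mxE eqxx -/u yq.
exists k, p; rewrite /tent -/u.
have := rho_lipschitz x (node k p); have := rho_lipschitz (node k p) x.
rewrite (distrC (node k p)) => r1 r2.
rewrite xp in yp r1 r2 *.
(* Here [rho x] lies between [8 * u] and [16 * u] and the node is within [3 * u] of [x]. *)
have -> : 5 * u <= rho (node k p) <= 19 * u by apply/andP; split; lra.
rewrite max_r; last by lra.
(* Either the tent has reached 0 at [y], a drop of at least [4 * u - 3 * u], or it has descended by
   at least [|x - y|]. *)
set m := Num.max _ _; have m0 : m <= 4 * u - `|x ord0 i - u * q%:~R| - u \/
   m <= 4 * u - `|x ord0 i - u * q%:~R| - `|x - y|.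
  by rewrite /m; have [?|?] := leP 0 (4 * u - `|y - node k p|); [right|left];
    lra.
rewrite ge_min; apply/orP;
  have := ler_norm (4 * u - `|x ord0 i - u * q%:~R| - m).
have := normr_ge0 (x - y); by case: m0 => ? ? ?; [right|left]; lra.
Qed.

Definition whitney (j : nat) x : R :=
  if pickle_inv j is Some kp then tent kp.1 kp.2 x else 0.

Lemma whitney_ge0 j x : 0 <= whitney j x.
Proof. by rewrite /whitney; case: pickle_inv => // kp; exact: tent_ge0. Qed.

Lemma whitney_out j x : ~ Omega x -> whitney j x = 0.
Proof. by move=> Ox; rewrite /whitney; case: pickle_inv => // kp;
  exact: tent_out. Qed.

Lemma whitney_lipschitz j x y : `|whitney j x - whitney j y| <= `|x - y|.
Proof.
by rewrite /whitney; case: pickle_inv => [kp|];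
  [exact: tent_lipschitz|rewrite subrr normr0].
Qed.

Lemma whitney_separates x y : exists j,
  Num.min `|x - y| (Num.max (rho x) (rho y)) <= 16 * `|whitney j x - whitney j
    y|.
Proof.
wlog yx : x y / rho y <= rho x.
  move=> H; case/orP: (le_total (rho y) (rho x)) => [/H//|/H[j]].
  by rewrite (distrC y) maxC (distrC (whitney j y)) => ?; exists j.
have [k [p kp]] := exists_separating_tent x y.
by exists (pickle (k, p)); rewrite /whitney pickleK_inv/= max_l.
Qed.

Lemma count_whitney x T :
  (count (fun j => whitney j x != 0)%R (iota 0 T) <= 5 * 8 ^ n)%N.
Proof.
rewrite -size_filter; set s := (X in size X).
(* The value [code 0] is a placeholder: an active index is always the code of a node. *)
pose c j := if pickle_inv j is Some kp then code kp else code 0.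
rewrite -(size_map c) -[leqRHS](_ : #|{: 'I_5 * {ffun 'I_n -> 'I_8}}| = _)%N;
  last first.
  by rewrite card_prod card_ffun !card_ord.
rewrite -(card_uniqP _) ?max_card// map_inj_in_uniq ?filter_uniq ?iota_uniq//.
move=> i j; rewrite !mem_filter /whitney /c => /andP[+ _] /andP[+ _].
case: (pickle_inv i) (@pickle_invK (int * 'rV[int]_n)%type i) => [kp /= kpi|];
  last by rewrite eqxx.
case: (pickle_inv j) (@pickle_invK (int * 'rV[int]_n)%type j) => [kp' /= kpj|];
  last by rewrite eqxx.
by move=> + + cc; rewrite -kpi -kpj => a b; rewrite (code_inj a b cc).
Qed.

(** Infinitely many active indices at [x] would contradict the bound of [count_whitney], which is
    uniform in [T]. *)
Lemma whitney_eventually0 x : exists T, forall j, (T <= j)%N -> whitney j x = 0.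
Proof.
apply: contrapT => H.
have inf T : exists2 j, (T <= j)%N & whitney j x != 0.
  apply: contrapT => HT; apply: H; exists T => j Tj.
  by apply: contrapT => /eqP jx; apply: HT; exists j.
have big N : exists T, (N <= count (fun j => whitney j x != 0)%R (iota 0 T))%N.
  elim: N => [|N [T NT]]; first by exists 0%N.
  have [j Tj jx] := inf T; exists j.+1.
  rewrite -[j.+1]addn1 iotaD count_cat /= add0n jx addn0 addn1 ltnS.
  by rewrite (leq_trans NT)// -(subnKC Tj) iotaD count_cat leq_addr.
have [T] := big (5 * 8 ^ n).+1; rewrite ltnNge => /negP; apply.
exact: count_whitney.
Qed.

(** Only indices active at [x] or at [y] contribute, at most [5 * 8 ^ n] for each point. *)
Lemma sum_whitney_lipschitz x y T :
  \sum_(j < T) `|whitney j x - whitney j y| <= (10 * 8 ^ n)%:R * `|x - y|.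
Proof.
pose a z j : R := (whitney j z != 0)%R%:R.
rewrite (le_trans (y := \sum_(j < T) (a x j + a y j) * `|x - y|))//.
  apply: ler_sum => j _; rewrite /a.
  case: (eqVneq (whitney j x) 0) => [Hx|_]; last first.
    by rewrite (le_trans (whitney_lipschitz _ _ _))// ler_peMl//= lerDl.
  case: (eqVneq (whitney j y) 0) => [Hy|_]; first by
    rewrite Hx Hy subrr normr0 addr0 mul0r.
  by rewrite add0r mul1r whitney_lipschitz.
rewrite -mulr_suml ler_wpM2r// big_split /= /a.
have cnt z : \sum_(j < T) a z j <= (5 * 8 ^ n)%:R.
  rewrite -natr_sum ler_nat (leq_trans _ (count_whitney z T))//.
  rewrite -sum1_count (_ : iota 0 T = index_iota 0 T);
    last by rewrite /index_iota subn0.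
  rewrite big_mkord [leqRHS]big_mkcond /=.
  by apply: leq_sum => j _; case: (_ != 0).
rewrite (le_trans (lerD (cnt x) (cnt y)))// -natrD ler_nat; lia.
Qed.

End whitney_tents.

(** * Order statistics and couplings *)

Section order_statistics.
Context {R : realType} {X : eqType}.
Implicit Types (f : X -> R) (s : seq X) (a : R).

Definition sort_by f s : seq X := sort (relpre f >=%R) s.

(* Indices start at 0, and [ostat f s 0] is the largest value. *)
Definition ostat f s (i : nat) : R := nth 0 (map f (sort_by f s)) i.

Let ostat_mono f s : {in [pred i | (i < size s)%N] &,
  forall i j, (i <= j)%N -> ostat f s j <= ostat f s i}.
Proof.
move=> i j; rewrite !inE => im jm.
apply: (@sorted_leq_nth R >=%R); rewrite ?inE ?size_map ?size_sort//.
- by move=> x y z /= xy zx; exact: le_trans zx xy.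
- by move=> x /=.
- by rewrite /sort_by -sort_map sort_sorted// => x y; exact: le_total.
Qed.

Let count_ostat (p : pred R) f s :
  count (p \o f) s = count p (map f (sort_by f s)).
Proof. by rewrite count_map /sort_by count_sort. Qed.

(** The values of ranks 0 to [i] are all at least [a], which makes [i.+1] of them. *)
Lemma count_ge_ostat f s i a : (i < size s)%N -> a <= ostat f s i ->
  (i < count (fun x => (a <= f x)%R) s)%N.
Proof.
move=> im ai; rewrite (count_ostat (fun b =>
  a <= b)) -(cat_take_drop i.+1 (map f _)) count_cat.
set u := take _ _; have su : size u = i.+1.
  by rewrite size_takel// size_map size_sort.
suff /eqP -> : count (fun b => a <= b) u == size u by rewrite su leq_addr.
rewrite -all_count; apply/(all_nthP 0) => j; rewrite su => ji.
rewrite nth_take// (le_trans ai)// ostat_mono// !inE.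
exact: leq_trans ji im.
Qed.

(** Only ranks below [i] can exceed [a]. Against [count_ge_ostat] this leaves a gap of one unit of
    mass. *)
Lemma count_gt_ostat f s i a : (i < size s)%N -> ostat f s i <= a ->
  (count (fun x => (a < f x)%R) s <= i)%N.
Proof.
move=> im ai; rewrite (count_ostat (fun b =>
  a < b)) -(cat_take_drop i (map f _)) count_cat.
set u := take _ _; set v := drop _ _.
suff -> : count (fun b => a < b) v = 0%N.
  rewrite addn0 (leq_trans (count_size _ _))// size_takel//
    size_map size_sort ltnW//.
apply/eqP; rewrite -leqn0 leqNgt -has_count;
  apply/hasPn => _ /(nthP 0)[j jv <-].
move: jv; rewrite size_drop size_map size_sort => jv.
rewrite -leNgt nth_drop (le_trans _ ai)// ostat_mono ?inE// ?leq_addr//.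
by rewrite -ltn_subRL.
Qed.

Lemma ostat_ge0 f s i : (forall x, 0 <= f x) -> 0 <= ostat f s i.
Proof.
move=> f0; rewrite /ostat; have [im|mi] := ltnP i (size (map f (sort_by f s))).
  by have /mapP[x _ ->] := mem_nth 0 im.
by rewrite nth_default.
Qed.

(** Order statistics of equal rank correspond to the matching that zips the two sorted sequences. *)
Lemma sum_ostatB (F : R -> R) f s t : size s = size t ->
  \sum_(i < size s) F (ostat f s i - ostat f t i)
    = \sum_(p <- zip (sort_by f s) (sort_by f t)) F (f p.1 - f p.2).
Proof.
move=> st; case: s st => [|x0 s] st.
  by case: t st => // _; rewrite big_ord0 big_nil.
rewrite (big_nth (x0, x0)) size_zip !size_sort -st minnn big_mkord.
apply: eq_bigr => i _; rewrite nth_zip ?size_sort// /ostat.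
by rewrite !(nth_map x0) ?size_sort -?st.
Qed.

End order_statistics.

(** * Borel measurability and a Markov-type inequality *)

Section borel_sets.
Context {R : realType} {T : normedModType R}.

Lemma open_borel (A : set (borel T)) : open (A : set T) -> measurable A.
Proof. by move=> oA; exact: sub_sigma_algebra. Qed.

Lemma closed_borel (A : set (borel T)) : closed (A : set T) -> measurable A.
Proof.
move=> cA; rewrite -[A]setCK; apply: measurableC; apply: open_borel.
exact: (@closed_openC T).
Qed.

Lemma continuous_borel (g : borel T -> R) : continuous (g : T -> R) ->
  measurable_fun setT g.
Proof.
move=> cg; apply: (measurability _ (RGenOpens.measurableE R)).
move=> _ [_ [a [b ->]] <-]; rewrite setTI; apply: open_borel.
by apply: open_comp; [move=> x _; exact: cg|exact: interval_open].
Qed.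

End borel_sets.

Lemma continuous_borel_preimage {R : realType} {T U : normedModType R}
    (g : borel T -> borel U) (A : set (borel U)) :
  continuous (g : T -> U) -> measurable A -> measurable (g @^-1` A).
Proof.
move=> cg mA; rewrite -[_ @^-1` _]setTI.
suff mg : measurable_fun setT g by exact: mg.
apply: (@measurability _ _ (borel T) (borel U) setT g (@open U)) => //.
move=> _ [B oB <-]; rewrite setTI; apply: open_borel.
by apply: open_comp => // x _; exact: cg.
Qed.

Section markov.
Context d (T : measurableType d) {R : realType}.
Variable gamma : {measure set T -> \bar R}.

(** By subadditivity [P] minus [Q] has mass at least 1, and [g] is at least [c] there. Only the
    finite number [i] is cancelled, so [gamma] may have infinite mass. *)
Lemma integral_ge_mass_gap (P Q : set T) (g : T -> R) (c : R) (i : nat) :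
  measurable P -> measurable Q -> (i.+1%:R%:E <= gamma P)%E ->
  (gamma Q <= i%:R%:E)%E -> measurable_fun setT g -> (forall z, 0 <= g z) ->
  0 <= c -> (forall z, P z -> ~ Q z -> c <= g z) ->
  (c%:E <= \int[gamma]_z (g z)%:E)%E.
Proof.
move=> mP mQ iP Qi mg g0 c0 cg;
  have mPQ : measurable (P `\` Q) by exact: measurableD.
have PQ1 : (1 <= gamma (P `\` Q))%E.
  have PPQ : (gamma P <= gamma (P `\` Q) + gamma Q)%E.
    apply: le_trans (measureU2 _ mPQ mQ).
    apply: le_measure; rewrite ?inE//; first exact: measurableU.
    by move=> z Pz; have [Qz|Qz] := pselect (Q z); [right|left].
  have := le_trans iP (le_trans PPQ (leeD (lexx _) Qi)).
  by rewrite -natr1 EFinD addeC leeD2rE.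
apply: (@le_trans _ _ (\int[gamma]_(z in P `\` Q) (cst c%:E z))%E).
  by rewrite integral_cst// lee_pemulr// lee_fin.
apply: (@le_trans _ _ (\int[gamma]_(z in P `\` Q) (g z)%:E)%E).
  apply: ge0_le_integral => //=.
  - by apply/measurable_EFinP; exact: measurable_funTS.
  - by move=> z [Pz Qz]; rewrite lee_fin cg.
apply: ge0_subset_integral => //; first exact/measurable_EFinP.
by move=> z _; rewrite lee_fin.
Qed.

End markov.

Section euclidean_distance.
Context {R : realType} {n : nat}.
Implicit Types x y : 'rV[R]_n.

Lemma sqr_eucl_dist x y :
  eucl_dist x y ^+ 2 = \sum_(i < n) (x ord0 i - y ord0 i) ^+ 2.
Proof. by rewrite sqr_sqrtr// sumr_ge0// => i _; exact: sqr_ge0. Qed.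

Lemma normr_le_eucl_dist x y : `|x - y| <= eucl_dist x y.
Proof.
apply: normr_coord_le; first exact: sqrtr_ge0.
move=> j; rewrite !mxE -sqrtr_sqr ler_sqrt; last first.
  by rewrite sumr_ge0// => i _; exact: sqr_ge0.
by rewrite (bigD1 j)//= lerDl sumr_ge0// => i _; exact: sqr_ge0.
Qed.

Lemma sqr_eucl_dist_le x y : eucl_dist x y ^+ 2 <= n%:R * `|x - y| ^+ 2.
Proof.
rewrite sqr_eucl_dist.
have -> : n%:R * `|x - y| ^+ 2 = \sum_(i < n) `|x - y| ^+ 2.
  by rewrite sumr_const card_ord mulr_natl.
apply: ler_sum => i _.
rewrite -[leLHS]real_normK ?num_real// ler_pXn2r ?nnegrE//.
by have := normr_coord (x - y) i; rewrite !mxE.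
Qed.

Lemma measurable_sqr_eucl_dist :
  measurable_fun setT
    ((fun z => eucl_dist z.1 z.2 ^+ 2) : borel ('rV[R]_n * 'rV[R]_n)%type -> R).
Proof.
rewrite (_ : (fun _ => _) = fun z : borel ('rV[R]_n * 'rV[R]_n)%type =>
    \sum_(i < n) (z.1 ord0 i - z.2 ord0 i) ^+ 2); last first.
  by apply/funext => z; rewrite sqr_eucl_dist.
apply: measurable_sum => i; apply: measurable_funX; apply: measurable_funB.
- apply: (@continuous_borel R ('rV[R]_n * 'rV[R]_n)%type) => z.
  apply: (@continuous_comp _ _ _ fst (fun x : 'rV[R]_n => x ord0 i));
    first exact: cvg_fst.
  exact: coord_continuous.
- apply: (@continuous_borel R ('rV[R]_n * 'rV[R]_n)%type) => z.
  apply: (@continuous_comp _ _ _ snd (fun x : 'rV[R]_n => x ord0 i));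
    first exact: cvg_snd.
  exact: coord_continuous.
Qed.

End euclidean_distance.

Lemma lipschitz_normr_continuous {R : realType} {V : normedModType R} (f : V ->
  R) (L : R) :
  0 <= L -> (forall x y, `|f x - f y| <= L * `|x - y|) -> continuous f.
Proof.
move=> L0 fL x; apply/cvgrPdist_lt => e e0; apply/nbhs_ballP.
(* Adding 1 avoids a division by 0 when [L] is 0. *)
exists (e / (L + 1)); first by rewrite /= divr_gt0// ltr_wpDl.
move=> y; rewrite -ball_normE /= ltr_pdivlMr ?ltr_wpDl// => xy.
rewrite (le_lt_trans (fL x y))// (le_lt_trans _ xy)// mulrC ler_wpM2l//.
by rewrite lerDl.
Qed.

(** * Order statistics bound the cost of every coupling from below *)

Section couplings.
Context {R : realType} {n : nat} (Omega : set 'rV[R]_n) (z0 : 'rV[R]_n).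
Hypotheses (oO : open Omega) (OT : Omega <> setT) (Oz0 : ~ Omega z0).
Let X := 'rV[R]_n.
Implicit Types (s t : seq X) (mu nu : borel_measure X R).

(* A measure of mass at most [size s] is padded by the exterior point z0. *)
Definition represents mu s : Prop :=
  (forall x, x \in s -> Omega x \/ x = z0) /\
  (forall A, mu A = \sum_(x <- s | `[< Omega x >]) \d_(x : borel X) A)%E.

Lemma represents_count mu s (A : set (borel X)) : represents mu s ->
  A `<=` Omega -> mu A = (count (fun x => x \in A) s)%:R%:E.
Proof.
move=> [_ ->] AO; under eq_bigr do rewrite diracE.
rewrite sumEFin -natr_sum; congr (_%:R%:E).
rewrite big_mkcond -sum1_count [RHS]big_mkcond; apply: eq_bigr => x _ /=.
by case: ifPn => [//|/asboolPn Ox]; rewrite memNset// => /AO.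
Qed.

Section order_statistics_lipschitz.
Variables (f : X -> R) (L : R).
Hypotheses (f0 : forall x, 0 <= f x) (fout : forall x, ~ Omega x -> f x = 0).
Hypotheses (L0 : 0 <= L) (fL : forall x y, `|f x - f y| <= L * `|x - y|).

Let cf : continuous f. Proof. exact: (lipschitz_normr_continuous L0 fL). Qed.

(** A coupling prescribes its marginals inside [Omega] only, so the level sets that are measured
    have to lie there. *)
Let above_subset (a : R) : 0 < a -> [set x | a <= f x] `<=` Omega.
Proof.
move=> a0 x /= ax; apply: contrapT => /fout fx; move: ax.
by rewrite fx leNgt a0.
Qed.

Let measurable_ge (a : R) : measurable ([set x | a <= f x] : set (borel X)).
Proof.
apply: closed_borel; apply: (@closed_comp _ _ f [set y | a <= y]).
  by move=> x _; exact: cf.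
exact: closed_ge.
Qed.

Let measurable_gt (a : R) : measurable ([set x | a < f x] : set (borel X)).
Proof.
apply: open_borel; apply: (@open_comp _ _ f [set y | a < y]).
  by move=> x _; exact: cf.
exact: open_gt.
Qed.

(** The maps [p] and [q] stand for the two projections in either order, so one inequality between
    the order statistics covers both cases. *)
Let ostat_transport (gamma : borel_measure (X * X) R) (p q : X * X -> X)
    (mu nu : borel_measure X R) s t i :
  continuous p -> continuous q ->
  (forall z, `|p z - q z| <= eucl_dist z.1 z.2) ->
  eq_restr Omega (pushforward gamma (p : borel (X * X) -> borel X)) mu ->
  eq_restr Omega (pushforward gamma (q : borel (X * X) -> borel X)) nu ->
  represents mu s -> represents nu t -> size s = size t -> (i < size s)%N ->
  ostat f t i <= ostat f s i ->
  (((ostat f s i - ostat f t i) ^+ 2)%:E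
    <= \int[gamma]_z (L ^+ 2 * eucl_dist z.1 z.2 ^+ 2)%:E)%E.
Proof.
move=> cp cq pq pmu qnu smu tnu st im ts.
have int_ge0 : (0 <= \int[gamma]_z (L ^+ 2 * eucl_dist z.1 z.2 ^+ 2)%:E)%E.
  by apply: integral_ge0 => z _; rewrite lee_fin mulr_ge0// sqr_ge0.
(* Equality is set apart because the common value may be 0, and the set where [f] is at least 0 is
   not contained in [Omega]. *)
have [->|] := eqVneq (ostat f s i) (ostat f t i).
  by rewrite subrr expr0n.
rewrite eq_sym => st_neq; set a := ostat f s i in ts st_neq *;
  set b := ostat f t i in ts st_neq *.
have ab : b < a by rewrite lt_neqAle st_neq.
have b0 : 0 <= b by exact: ostat_ge0.
(* The first set has mass at least [i.+1], the second at most [i]. On their difference [f] drops by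
   at least [a - b] from [p z] to [q z]. *)
apply: (@integral_ge_mass_gap _ _ _ gamma (p @^-1` [set x | a <= f x])
  (q @^-1` [set x | b < f x]) _ _ i).
- exact: continuous_borel_preimage.
- exact: continuous_borel_preimage.
- have -> : gamma (p @^-1` [set x | a <= f x]) = mu [set x | a <= f x].
    by apply: pmu => //; apply: above_subset; exact: le_lt_trans ab.
  rewrite (represents_count smu); last by apply: above_subset;
    exact: le_lt_trans ab.
  rewrite lee_fin ler_nat (eq_count (a2 := fun x => a <= f x)); last first.
    by move=> x; apply/idP/idP => [/set_mem//|?]; rewrite inE.
  exact: count_ge_ostat.
- have subO : [set x | b < f x] `<=` Omega.
    move=> x /= bx; apply: contrapT => /fout fx; move: bx.
    by rewrite fx ltNge b0.
  have -> : gamma (q @^-1` [set x | b < f x]) = nu [set x | b < f x].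
    exact: qnu.
  rewrite (represents_count tnu)// lee_fin ler_nat.
  rewrite (eq_count (a2 := fun x => b < f x)); last first.
    by move=> x; apply/idP/idP => [/set_mem//|?]; rewrite inE.
  by apply: count_gt_ostat; rewrite -?st.
- by apply: measurable_funM => //; exact: measurable_sqr_eucl_dist.
- by move=> z; rewrite mulr_ge0// sqr_ge0.
- exact: sqr_ge0.
- move=> z /= az /negP; rewrite -leNgt => zb.
  rewrite -exprMn ler_pXn2r ?nnegrE ?subr_ge0 ?mulr_ge0 ?sqrtr_ge0//.
  rewrite (le_trans (lerB az zb))// (le_trans (ler_norm _))//.
  by rewrite (le_trans (fL _ _))// ler_wpM2l.
Qed.

Lemma ostat_coupling mu nu s t (gamma : borel_measure (X * X) R) i :
  represents mu s -> represents nu t -> size s = size t -> (i < size s)%N ->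
  coupling Omega mu nu gamma ->
  (((ostat f s i - ostat f t i) ^+ 2)%:E
    <= (L ^+ 2)%:E * \int[gamma]_z (eucl_dist z.1 z.2 ^+ 2)%:E)%E.
Proof.
move=> smu tnu st im [gmu gnu].
rewrite -ge0_integralZl_EFin//; last 3 first.
- by move=> z _; rewrite lee_fin; exact: sqr_ge0.
- by apply/measurable_EFinP; exact: measurable_sqr_eucl_dist.
- exact: sqr_ge0.
have [ts|/ltW ts] := leP (ostat f t i) (ostat f s i).
  apply: (@ostat_transport gamma fst snd mu nu) => //.
  - by move=> z; exact: cvg_fst.
  - by move=> z; exact: cvg_snd.
  - by move=> z; exact: normr_le_eucl_dist.
rewrite -sqrrN opprB; apply: (@ostat_transport gamma snd fst nu mu) => //.
- by move=> z; exact: cvg_snd.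
- by move=> z; exact: cvg_fst.
- by move=> z; rewrite distrC; exact: normr_le_eucl_dist.
- by rewrite -st.
Qed.

End order_statistics_lipschitz.
End couplings.

(** * Explicit couplings bound [Wb2] from above *)

Section discrete_couplings.
Context {R : realType} {n : nat} (Omega : set 'rV[R]_n) (z0 : 'rV[R]_n).
Hypotheses (oO : open Omega) (OT : Omega <> setT) (Oz0 : ~ Omega z0).
Let X := 'rV[R]_n.
Implicit Types (s t : seq X) (l : seq (X * X)) (mu nu : borel_measure X R).

Definition sum_dirac l : borel_measure (X * X) R :=
  msum (fun k => \d_(nth (z0, z0) l k : borel (X * X))) (size l).

Lemma sum_diracE l A :
  sum_dirac l A = (\sum_(z <- l) \d_(z : borel (X * X)) A)%E.
Proof. by rewrite (big_nth (z0, z0)) big_mkord. Qed.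

Lemma integral_sum_dirac l (g : borel (X * X) -> R) :
  measurable_fun setT g -> (forall z, 0 <= g z) ->
  (\int[sum_dirac l]_z (g z)%:E = (\sum_(z <- l) g z)%:E)%E.
Proof.
move=> mg g0; rewrite ge0_integral_measure_sum//; last 2 first.
- by move=> z _; rewrite lee_fin.
- exact/measurable_EFinP.
rewrite (big_nth (z0, z0)) big_mkord -sumEFin; apply: eq_bigr => k _.
by rewrite integral_dirac//; [rewrite diracT mul1e|exact/measurable_EFinP].
Qed.

(* The transport cost of a pair, up to constants, when mass may be created and
   destroyed at the boundary. *)
Definition shortcut (p : X * X) : R :=
  Num.min `|p.1 - p.2| (Num.max (rho Omega p.1) (rho Omega p.2)).

Lemma shortcut_ge0 p : 0 <= shortcut p.
Proof. by rewrite le_min normr_ge0 le_max rho_ge0. Qed.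

(** Either the mass moves directly, or it leaves [Omega] near the first point and enters it near the
    second. The exterior endpoints are invisible to the marginal conditions. *)
Lemma exists_transport_plan (p : X * X) : exists l : seq (X * X),
  [/\ forall x, Omega x -> count (fun z => z.1 == x) l = (p.1 == x) :> nat,
      forall x, Omega x -> count (fun z => z.2 == x) l = (p.2 == x) :> nat &
      \sum_(z <- l) eucl_dist z.1 z.2 ^+ 2 <= 8 * n%:R * shortcut p ^+ 2].
Proof.
case: p => x y; rewrite /shortcut /=; set d := Num.max _ _.
have n8 (r : R) : 0 <= r -> n%:R * r <= 8 * n%:R * r.
  by move=> r0; rewrite ler_wpM2r// ler_peMl// ler1n.
have [xyd|dxy] := leP `|x - y| d.
  exists [:: (x, y)]; split=> [u _|u _|]; rewrite /= ?addn0//.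
  by rewrite big_seq1 /= (le_trans (sqr_eucl_dist_le _ _))// n8// sqr_ge0.
have [b Ob xb] := exists_near_boundary oO OT x.
have [c Oc yc] := exists_near_boundary oO OT y.
exists [:: (x, b); (c, y)]; split=> [u Ou|u Ou|] /=.
- by rewrite addn0 (_ : c == u = false) ?addn0//; apply/eqP => cu;
  rewrite cu in Oc.
- by rewrite addn0 (_ : b == u = false) ?add0n//; apply/eqP => bu;
  rewrite bu in Ob.
(* A leg has sup length at most [2 * d], hence squared Euclidean length at most [4 * n * d ^ 2]; two
   legs give the factor 8. *)
have bd (u v : X) r : `|u - v| <= 2 * r -> r <= d ->
    eucl_dist u v ^+ 2 <= n%:R * (4 * d ^+ 2).
  move=> uv rd; rewrite (le_trans (sqr_eucl_dist_le _ _))// ler_wpM2l//.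
  have uvd : `|u - v| <= 2 * d by lra.
  rewrite (_ : 4 * d ^+ 2 = (2 * d) ^+ 2); last by ring.
  by rewrite ler_pXn2r// nnegrE// (le_trans _ uvd).
rewrite big_cons big_seq1 /=.
have := bd _ _ _ xb; rewrite le_max lexx => /(_ isT) h1.
have h2 : eucl_dist c y ^+ 2 <= n%:R * (4 * d ^+ 2).
  by apply: (bd _ _ (rho Omega y)); rewrite 1?distrC// le_max lexx orbT.
by rewrite (le_trans (lerD h1 h2))// le_eqVlt; apply/orP; left; apply/eqP; ring.
Qed.

(** Inside [Omega] the points [p z] reduce to the single point [x], or to none when [x] lies
    outside. *)
Let count_set (T : eqType) (p : T -> X) (l : seq T) (A : set (borel X))
    (x : X) :
  (forall u, Omega u -> count (fun z => p z == u) l = (x == u) :> nat) ->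
  A `<=` Omega -> count (fun z => p z \in A) l = (x \in A) :> nat.
Proof.
move=> pl AO; have [xA|xA] := boolP (x \in A).
  have Ox : Omega x by apply: AO; exact: set_mem.
  transitivity (count (fun z => p z == x) l); last by rewrite pl// eqxx.
  apply: eq_in_count => z zl; apply/idP/eqP => [zA|->//].
  have Oz : Omega (p z) by apply: AO; exact: set_mem.
  apply/eqP; apply: contraT => xz; have := pl _ Oz.
  rewrite eq_sym (negbTE xz) => /eqP; rewrite -leqn0 leqNgt -has_count.
  by case/negP; apply/hasP; exists z.
apply/eqP; rewrite -leqn0 leqNgt -has_count; apply/negP => /hasP[z zl zA].
have Oz : Omega (p z) by apply: AO; exact: set_mem.
have := pl _ Oz; case: eqVneq => [xz|_ /eqP]; first by rewrite xz zA in xA.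
by rewrite -leqn0 leqNgt -has_count => /negP[]; apply/hasP; exists z.
Qed.

(** The plans of the matched pairs are concatenated; their marginal counts and their costs add
    up. *)
Lemma exists_coupling mu nu s t s' t' :
  represents Omega z0 mu s -> represents Omega z0 nu t ->
  perm_eq s' s -> perm_eq t' t -> size s' = size t' ->
  exists2 l, coupling Omega mu nu (sum_dirac l) &
    \sum_(z <- l) eucl_dist z.1 z.2 ^+ 2
      <= 8 * n%:R * \sum_(p <- zip s' t') shortcut p ^+ 2.
Proof.
move=> smu tnu s's t't st'; have /choice[plan planP] := exists_transport_plan.
pose l := flatten (map plan (zip s' t')).
have countl (q : X * X -> X) (A : set (borel X)) : A `<=` Omega ->
    (forall p x, Omega x -> count (fun z =>
      q z == x) (plan p) = (q p == x) :> nat) ->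
    count (fun z => q z \in A) l = count (fun p => q p \in A) (zip s' t').
  move=> AO qP; rewrite /l count_flatten -map_comp.
  elim: (zip s' t') => [//|p r IHr] /=; rewrite IHr.
  by congr (_ + _)%N; apply: count_set AO => u Ou; exact: qP.
have diracl (q : X * X -> X) (A : set (borel X)) :
    (\sum_(z <- l) \d_(z : borel (X * X)) (q @^-1` A)
      = (count (fun z => q z \in A) l)%:R%:E :> \bar R)%E.
  under eq_bigr do rewrite diracE.
  by rewrite sumEFin -natr_sum -sum1_count [in RHS]big_mkcond.
exists l.
  split=> A mA AO; rewrite /pushforward sum_diracE diracl.
  - rewrite countl//; last by move=> p x; have [+ _ _] := planP p; exact.
    rewrite (represents_count smu AO) -(permP s's) -[s' in RHS](unzip1_zip (t
      := t')) ?st'//.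
    by rewrite count_map.
  - rewrite countl//; last by move=> p x; have [_ + _] := planP p; exact.
    rewrite (represents_count tnu AO) -(permP t't) -[t' in RHS](unzip2_zip (s
      := s')) ?st'//.
    by rewrite count_map.
rewrite big_flatten big_map mulr_sumr; apply: ler_sum => p _.
by have [_ _] := planP p.
Qed.

Lemma Wb2_le mu nu s t s' t' :
  represents Omega z0 mu s -> represents Omega z0 nu t ->
  perm_eq s' s -> perm_eq t' t -> size s' = size t' ->
  (Wb2 Omega mu nu <=
    (Num.sqrt (8 * n%:R * \sum_(p <- zip s' t') shortcut p ^+ 2))%:E)%E.
Proof.
move=> smu tnu s's t't st'.
have [l lc lcost] := exists_coupling smu tnu s's t't st'.
apply: (@le_trans _ _ (sqrte (\int[sum_dirac l]_z (eucl_dist z.1 z.2 ^+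
  2)%:E)%E)).
  by apply: ereal_inf_lbound; exists (sum_dirac l).
rewrite integral_sum_dirac.
- by rewrite /= lee_fin ler_wsqrtr.
- exact: measurable_sqr_eucl_dist.
- by move=> z; exact: sqr_ge0.
Qed.

End discrete_couplings.

(** * The embedding *)

Lemma ostat_ext {R : realType} {X : eqType} (f g : X -> R) (s : seq X) i :
  {in s, f =1 g} -> ostat f s i = ostat g s i.
Proof.
by move=> fg; rewrite /ostat /sort_by -!sort_map; congr (nth _ (sort _ _) _);
  exact/eq_in_map.
Qed.

Lemma uniq_words_upto (K T : nat) :
  uniq (flatten [seq words K j | j <- iota 0 T]).
Proof.
elim: T => [//|T IHT]; rewrite -[T.+1]addn1 iotaD map_cat flatten_cat cat_uniq
  IHT /=.
rewrite cats0 uniq_words andbT; apply/hasPn => w;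
  rewrite mem_words add0n => /eqP wT.
apply/flatten_mapP => -[j]; rewrite mem_iota add0n mem_words => /= jT /eqP wj.
by rewrite -wT wj ltnn in jT.
Qed.

Lemma mem_words_upto (K T : nat) w :
  (w \in flatten [seq words K j | j <- iota 0 T]) = (size w < T)%N.
Proof.
apply/flatten_mapP/idP => [[j]|wT].
  by rewrite mem_iota mem_words => /= jT /eqP ->.
by exists (size w); rewrite ?mem_iota// mem_words.
Qed.

(** Padding by [z0] gives all configurations the same size, so they can be matched one to one, and
    puts no mass in [Omega]. *)
Lemma Bm_represents {R : realType} {n : nat} (Omega : set 'rV[R]_n) z0 m
    (mu : borel_measure 'rV[R]_n R) : ~ Omega z0 -> Bm Omega m mu ->
  exists2 s, represents Omega z0 mu s & size s = m.
Proof.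
move=> Oz0 [k /= /andP[_ km] [x xO muE]].
pose s := [seq (x i : 'rV[R]_n) | i <- enum 'I_k].
exists (s ++ nseq (m - k) z0); last first.
  by rewrite size_cat size_map size_enum_ord size_nseq subnKC.
split=> [y|A].
  rewrite mem_cat => /orP[/mapP[i _ ->]|/nseqP[-> _]]; last by right.
  by left; exact: xO.
rewrite muE big_cat /= [X in (_ + X)%E]big1_seq ?adde0; last first.
  by move=> y /andP[/asboolP Oy /nseqP[yz _]]; rewrite yz in Oy.
rewrite big_map big_enum_cond /=; apply: eq_big => // i.
by apply/esym/asboolP; exact: xO.
Qed.

Lemma represents_perm {R : realType} {n : nat} (Omega : set 'rV[R]_n) z0
    (mu nu : borel_measure 'rV[R]_n R) s t :
  represents Omega z0 mu s -> represents Omega z0 nu t -> perm_eq s t -> mu =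
    nu.
Proof.
move=> [_ muE] [_ nuE] st; apply: eq_measure; apply/funext => A.
by rewrite muE nuE; exact: perm_big.
Qed.

Lemma le_mul_sqrt {R : realType} (D A N q : R) :
  0 <= D -> 0 <= A -> 0 <= N -> 0 <= q -> D ^+ 2 <= A * (8 * q ^+ 2 * N * 2) ->
  D <= 4 * q * Num.sqrt N * Num.sqrt A.
Proof.
move=> D0 A0 N0 q0 DA.
rewrite -(@ler_pXn2r _ 2) ?nnegrE ?mulr_ge0 ?sqrtr_ge0// !exprMn !sqr_sqrtr//.
by rewrite (le_trans DA)// le_eqVlt; apply/orP; left; apply/eqP; ring.
Qed.

Section embedding.
Context {R : realType} {n : nat} (Omega : set 'rV[R]_n) (z0 : 'rV[R]_n) (m :
  nat).
Hypotheses (oO : open Omega) (OT : Omega <> setT) (Oz0 : ~ Omega z0).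
Let X := 'rV[R]_n.
(** The union bound over the [m ^ 2] pairs of points requires [2 * m ^ 2 <= K.+1]. *)
Let K : nat := (2 * m ^ 2)%N.
Let phi : nat -> X -> R := whitney Omega.
Local Notation W := (seq 'I_K.+1).
Implicit Types (s t : seq X) (w : W) (mu nu : borel_measure X R) (T : nat).

Let f w : X -> R := comb phi w.
Let L : R := K%:R * (10 * 8 ^ n)%:R.

Let f_lipschitz w x y : `|f w x - f w y| <= L * `|x - y|.
Proof.
rewrite (le_trans (comb_lipschitz _ _ _ _))// /L -mulrA ler_wpM2l//.
exact: sum_whitney_lipschitz.
Qed.

Let f_ge0 w x : 0 <= f w x.
Proof. by apply: comb_ge0 => j; exact: whitney_ge0. Qed.

Let f_out w x : ~ Omega x -> f w x = 0.
Proof. by move=> Ox; apply: comb_eq0 => j; exact: whitney_out. Qed.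

(** A horizon for [s]: letters from index [T] on do not affect [f] at the points of [s]. *)
Let vanishes T s := forall x j, x \in s -> (T <= j)%N -> phi j x = 0.

Let exists_vanishes s : exists T, vanishes T s.
Proof.
elim: s => [|x s [T Ts]]; first by exists 0%N.
have [T' T'x] := whitney_eventually0 OT x.
exists (maxn T T') => y j;
  rewrite inE geq_max => /orP[/eqP ->|ys] /andP[Tj T'j].
  exact: T'x.
exact: Ts.
Qed.

Let vanishesW T T' s : (T <= T')%N -> vanishes T s -> vanishes T' s.
Proof. by move=> TT' Ts x j xs T'j; apply: Ts => //; exact: leq_trans T'j. Qed.

Let h s (i : 'I_m) w : R := ostat (f w) s i.

Let h_stable T s i : vanishes T s -> stable T (h s i).
Proof.
move=> Ts a w Tw; apply: ostat_ext => x xs.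
by apply: (comb_cons_stable (T := T)) => // j; exact: Ts.
Qed.

Let coef T s (iw : 'I_m * W) : R := mart T (h s iw.1) iw.2.

Let support T : seq ('I_m * W) :=
  [seq (i, w) | i <- enum 'I_m, w <- flatten [seq words K j | j <- iota 0
    T.+1]].

Let uniq_support T : uniq (support T).
Proof.
apply: allpairs_uniq; rewrite ?enum_uniq ?uniq_words_upto//.
by move=> [i w] [j v] _ _ /= [-> ->].
Qed.

Let coef_eq0 T s iw : vanishes T s -> iw \notin support T -> coef T s iw = 0.
Proof.
case: iw => i w Ts iw; apply: (mart_eq0 (h_stable _ Ts)); rewrite ltnNge.
apply: contra iw => wT; apply/allpairsP; exists (i, w); split=> //.
  by rewrite mem_enum.
by rewrite mem_words_upto ltnS.
Qed.

Let sqdist s t w : R := \sum_(i < m) (h s i w - h t i w) ^+ 2.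

Let embeds (u : ell2 R) s T : Prop :=
  vanishes T s /\ u = lift_nat (coef T s) :> (nat -> R).

(** At a common horizon the difference of the coefficients is the martingale transform of
    [h s i - h t i], and [mart_parseval] applies for each [i]. *)
Let ell2_dist_embeds u u' s t T1 T2 T : embeds u s T1 -> embeds u' t T2 ->
  (T1 <= T)%N -> (T2 <= T)%N ->
  ell2_dist u u' = (Num.sqrt (avg T (sqdist s t) [::]))%:E.
Proof.
move=> [sT1 uE] [tT2 u'E] T1T T2T.
have cE s' T' : vanishes T' s' -> (T' <= T)%N -> coef T' s' = coef T s'.
  move=> sT TT; apply/funext => -[i w].
  by rewrite /coef (mart_stable (h_stable _ sT) TT).
rewrite (cE _ _ sT1 T1T) in uE; rewrite (cE _ _ tT2 T2T) in u'E.
rewrite (ell2_dist_lift uE u'E (uniq_support T)); last first.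
  move=> iw iwT.
  by rewrite !coef_eq0//;
    [exact: (vanishesW T2T tT2)|exact: (vanishesW T1T sT1)].
congr (Num.sqrt _)%:E; rewrite /sqdist avg_sum big_allpairs big_enum.
apply: eq_bigr => i _; rewrite -mart_parseval; apply: eq_bigr => w _.
by rewrite /coef martB.
Qed.

Let exists_embedding mu : exists u : ell2 R, Bm Omega m mu ->
  exists s T, [/\ represents Omega z0 mu s, size s = m & embeds u s T].
Proof.
(* Measures outside [Bm Omega m] get the value 0, so that choice yields a total function. *)
have [/(Bm_represents Oz0)[s smu sm]|nmu] := pselect (Bm Omega m mu);
  last by exists 0.
have [T Ts] := exists_vanishes s.
have [u uE] := ell2_lift (uniq_support T) (fun iw => @coef_eq0 T s iw Ts).
by exists u => _; exists s, T.
Qed.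

Let bound_upper : R := Num.sqrt m%:R * L.

Let upper mu nu s t u u' T1 T2 : (0 < m)%N ->
  represents Omega z0 mu s -> represents Omega z0 nu t ->
  size s = m -> size t = m -> embeds u s T1 -> embeds u' t T2 ->
  (ell2_dist u u' <= bound_upper%:E * Wb2 Omega mu nu)%E.
Proof.
move=> m0 smu tnu sm tm us ut.
have K0 : (0 < K)%N by rewrite muln_gt0 expn_gt0 m0.
have L0 : 0 < L by rewrite mulr_gt0// ltr0n// muln_gt0 expn_gt0.
have b0 : 0 < bound_upper by rewrite mulr_gt0// sqrtr_gt0 ltr0n.
rewrite (ell2_dist_embeds us ut (leq_maxl _ _) (leq_maxr _ _)).
(* Dividing by the positive constant turns the claim into a lower bound for an infimum, checked
   coupling by coupling. *)
rewrite muleC -lee_pdivrMr//; apply: le_ereal_inf_tmp => _ [gamma gc <-].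
rewrite lee_pdivrMr// muleC.
set I := (\int[gamma]_z _)%E.
have I0 : (0 <= I)%E by apply: integral_ge0 => z _; rewrite lee_fin sqr_ge0.
have key w i : (((h s i w - h t i w) ^+ 2)%:E <= (L ^+ 2)%:E * I)%E.
  apply: (ostat_coupling (f_ge0 w) (f_out w) (ltW L0) (f_lipschitz w) smu tnu)
    => //.
  - by rewrite sm.
  - by rewrite sm.
move: I0 key; case: I => [r| |//]; last first.
  by move=> _ _; rewrite gt0_muley ?lte_fin// leey.
rewrite lee_fin => r0 key; rewrite [sqrte _]/= -EFinM lee_fin.
have -> : bound_upper * Num.sqrt r = Num.sqrt (m%:R * (L ^+ 2 * r)).
  by rewrite sqrtrM// sqrtrM ?sqr_ge0// sqrtr_sqr gtr0_norm// mulrA.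
rewrite ler_wsqrtr//.
rewrite -[leRHS](avg_cst (K := K) (maxn T1 T2) _ [::]); apply: avg_le => w.
rewrite /sqdist (le_trans (y := \sum_(i < m) (L ^+ 2 * r)))//.
  by apply: ler_sum => i _; rewrite -lee_fin EFinM; exact: key.
by rewrite sumr_const card_ord mulr_natl.
Qed.

Let pairs s t : seq (X * X) := [seq (x, y) | x <- s, y <- t].

Let sorted_pairs s t w : seq (X * X) := zip (sort_by (f w) s) (sort_by (f w) t).

(** The sorted matching depends on the random word, so the union bound runs over all pairs, whatever
    the matching. *)
Let mem_sorted_pairs s t w p : size s = size t -> p \in sorted_pairs s t w ->
  p \in pairs s t.
Proof.
move=> st pz; apply/allpairsP; exists p; split; last by case: p {pz}.
- rewrite -(mem_sort (relpre (f w) >=%R)) -[sort _ _](unzip1_zip (t := sort_by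
  (f w) t)) ?map_f//.
  by rewrite !size_sort st.
- rewrite -(mem_sort (relpre (f w) >=%R)) -[sort _ _](unzip2_zip (s := sort_by
  (f w) s)) ?map_f//.
  by rewrite !size_sort st.
Qed.

Let sqdist_sorted_pairs s t w : size s = m -> size t = m ->
  sqdist s t w = \sum_(p <- sorted_pairs s t w) (f w p.1 - f w p.2) ^+ 2.
Proof.
by move=> sm tm; rewrite -(sum_ostatB (fun d => d ^+ 2)) ?sm ?tm//.
Qed.

(** The constant 32 is twice the 16 of [whitney_separates], as [avg_ge_half] asks for a separation
    by [2 * b]. *)
Let avg_sqdist_ge s t T (c : R) : (0 < T)%N -> vanishes T s -> vanishes T t ->
  size s = m -> size t = m -> 0 <= c ->
  (forall w, (forall p, p \in sorted_pairs s t w ->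
      shortcut Omega p / 32 <= `|f w p.1 - f w p.2|) -> c <= sqdist s t w) ->
  c / 2 <= avg T (sqdist s t) [::].
Proof.
move=> T0 sT tT sm tm c0 cG.
apply: (@avg_ge_half _ _ _ phi _ (pairs s t) (fun p =>
  shortcut Omega p / 32)) => //.
- by rewrite size_allpairs sm tm -mul2n mulnn leqnSn.
- by move=> w; apply: sumr_ge0 => i _; exact: sqr_ge0.
- move=> _ /allpairsP[[x y] /= [xs yt ->]] /=.
  have [j jxy] := whitney_separates OT x y.
  have [jT|Tj] := ltnP j T.
    by exists j => //; rewrite /shortcut /phi /=; lra.
  (* An index beyond the horizon separates by 0, so the shortcut is at most 0 and any index below
     [T] will do. *)
  exists 0%N => //; have := normr_ge0 (phi 0 x - phi 0 y).
  move: jxy; rewrite -/phi (sT x)// (tT y)// subrr normr0 /shortcut/=; lra.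
- move=> w good; apply: cG => p /mem_sorted_pairs pst; apply: good.
  by apply: pst; rewrite sm tm.
Qed.

(** Its square is [8 * 32 ^+ 2 * n.+1 * 2]: 8 from the transport plans, 32 from the separation, 2
    from the probability one half. *)
Let bound_lower : R := 4 * 32 * Num.sqrt n.+1%:R.

Let lower mu nu s t u u' T1 T2 :
  represents Omega z0 mu s -> represents Omega z0 nu t ->
  size s = m -> size t = m -> embeds u s T1 -> embeds u' t T2 ->
  (Wb2 Omega mu nu <= bound_lower%:E * ell2_dist u u')%E.
Proof.
move=> smu tnu sm tm us ut; pose T := (maxn T1 T2).+1.
have T1T : (T1 <= T)%N by rewrite leqW// leq_maxl.
have T2T : (T2 <= T)%N by rewrite leqW// leq_maxr.
rewrite (ell2_dist_embeds us ut T1T T2T).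
have sT := vanishesW T1T us.1; have tT := vanishesW T2T ut.1.
have Wle w : (Wb2 Omega mu nu <= (Num.sqrt (8 * n%:R *
    \sum_(p <- sorted_pairs s t w) shortcut Omega p ^+ 2))%:E)%E.
  by apply: (Wb2_le oO OT smu tnu); rewrite ?perm_sort// !size_sort sm tm.
have W0 : (0 <= Wb2 Omega mu nu)%E.
  by apply: le_ereal_inf_tmp => _ [gamma _ <-]; exact: sqrte_ge0.
move: W0 Wle; case: (Wb2 _ _ _) => [D| |//]; last first.
  (* One word, here the empty one, already shows that [Wb2] is finite. *)
  by move=> _ /(_ [::]); rewrite leNgt ltry.
rewrite lee_fin => D0 Wle.
(* [n.+1] instead of [n] keeps [b] positive in dimension 0. *)
pose b : R := 8 * 32 ^+ 2 * n.+1%:R.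
have b0 : 0 < b by rewrite /b !pmulr_rgt0// exprn_gt0.
have A0 : 0 <= avg T (sqdist s t) [::].
  rewrite -(avg_cst (K := K) T 0 [::]); apply: avg_le => w.
  by apply: sumr_ge0 => i _; exact: sqr_ge0.
suff DA : D ^+ 2 / b / 2 <= avg T (sqdist s t) [::].
  rewrite -EFinM lee_fin /bound_lower; apply: le_mul_sqrt => //.
  by move: DA; rewrite -mulrA -invfM ler_pdivrMr// mulr_gt0.
apply: avg_sqdist_ge => //; first by rewrite divr_ge0 ?sqr_ge0// ltW.
move=> w good; rewrite ler_pdivrMr//.
have DS : D ^+ 2 <= 8 * n%:R *
    \sum_(p <- sorted_pairs s t w) shortcut Omega p ^+ 2.
  have := Wle w; rewrite lee_fin => DS.
  rewrite -[leRHS]sqr_sqrtr ?ler_pXn2r ?nnegrE ?sqrtr_ge0//.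
  by rewrite mulr_ge0 ?mulr_ge0// sumr_ge0// => p _; exact: sqr_ge0.
have SG : \sum_(p <- sorted_pairs s t w) shortcut Omega p ^+ 2
    <= 32 ^+ 2 * sqdist s t w.
  rewrite sqdist_sorted_pairs// mulr_sumr big_seq [leRHS]big_seq.
  apply: ler_sum => p /good; rewrite ler_pdivrMr// => pg.
  rewrite -[X in _ * X]real_normK ?num_real// -exprMn.
  by rewrite ler_pXn2r ?nnegrE ?shortcut_ge0 ?mulr_ge0// mulrC.
rewrite (le_trans DS)//.
have -> : sqdist s t w * b = 8 * n.+1%:R * (32 ^+ 2 * sqdist s t w).
  by rewrite /b; move: (32 ^+ 2) => q; ring.
rewrite ler_pM ?mulr_ge0//; last by rewrite ler_wpM2l// ler_nat.
by rewrite sumr_ge0// => p _; exact: sqr_ge0.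
Qed.

Let positive_minimum (r : seq (X * X)) : exists2 e : R, 0 < e &
  forall p, p \in r -> 0 < shortcut Omega p -> e <= shortcut Omega p.
Proof.
elim: r => [|q r [e e0 er]]; first by exists 1.
have [q0|q0] := ltP 0 (shortcut Omega q).
  exists (Num.min e (shortcut Omega q)); first by rewrite lt_min e0.
  move=> p; rewrite inE => /orP[/eqP -> _|pr p0]; rewrite ge_min ?lexx ?orbT//.
  by rewrite er.
exists e => // p; rewrite inE => /orP[/eqP ->|];
  [by rewrite ltNge q0|exact: er].
Qed.

Let shortcut_gt0 (p : X * X) : Omega p.1 \/ p.1 = z0 -> Omega p.2 \/ p.2 = z0 ->
  p.1 != p.2 -> 0 < shortcut Omega p.
Proof.
move=> p1 p2 p12; rewrite lt_min normr_gt0 subr_eq0 p12 /= lt_max.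
case: p1 => [/(rho_gt0 oO OT)->//|p1].
case: p2 => [/(rho_gt0 oO OT)->|p2]; first by rewrite orbT.
by rewrite p1 p2 eqxx in p12.
Qed.

(** If [s] and [t] are not permutations of each other, every matching contains a pair of distinct
    points, whose shortcut is at least some [e > 0]. The distance from [u] to itself would then be
    positive. Deducing this from [lower] would require that [Wb2] separates measures. *)
Let embeds_inj mu nu s t u T1 T2 :
  represents Omega z0 mu s -> represents Omega z0 nu t ->
  size s = m -> size t = m -> embeds u s T1 -> embeds u t T2 -> mu = nu.
Proof.
move=> smu tnu sm tm us ut; have [|nst] := boolP (perm_eq s t).
  exact: represents_perm smu tnu.
exfalso; pose T := (maxn T1 T2).+1.
have T1T : (T1 <= T)%N by rewrite leqW// leq_maxl.
have T2T : (T2 <= T)%N by rewrite leqW// leq_maxr.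
have sT := vanishesW T1T us.1; have tT := vanishesW T2T ut.1.
have [e e0 emin] := positive_minimum (pairs s t).
have : (e / 32) ^+ 2 / 2 <= avg T (sqdist s t) [::].
  apply: avg_sqdist_ge => //; first exact: sqr_ge0.
  move=> w good; rewrite sqdist_sorted_pairs//.
  have [p pst p12] : exists2 p, p \in sorted_pairs s t w & p.1 != p.2.
    apply: contrapT => eqp; move/negP: nst; apply.
    suff E : sort_by (f w) s = sort_by (f w) t.
      by rewrite -(perm_sort (relpre (f w) >=%R)) -/(sort_by _ _) E perm_sort.
    have szE : size (sort_by (f w) s) = size (sort_by (f w) t).
      by rewrite !size_sort sm tm.
    rewrite -(unzip1_zip (s := sort_by (f w) s) (t := sort_by (f w) t)) ?szE//.
    rewrite -[RHS](unzip2_zip (s := sort_by (f w) s)) ?szE//.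
    apply/eq_in_map => p pst; apply/eqP; apply: contrapT => /negP p12.
    by apply: eqp; exists p.
  have /allpairsP[[x y] /= [xs yt pxy]] :=
    mem_sorted_pairs (etrans sm (esym tm)) pst.
  have p0 : 0 < shortcut Omega p.
    by apply: shortcut_gt0 => //; rewrite pxy /=; [exact: smu.1|exact: tnu.1].
  rewrite (big_rem p)//= (le_trans (y := (f w p.1 - f w p.2) ^+ 2))//;
    last first.
    by rewrite lerDl sumr_ge0// => q _; exact: sqr_ge0.
  rewrite -[leRHS]real_normK ?num_real//
    ler_pXn2r ?nnegrE ?divr_ge0 ?(ltW e0)//.
  rewrite (le_trans _ (good _ pst))// ler_pM2r//.
  by rewrite emin// (mem_sorted_pairs _ pst)// sm tm.
have : ell2_dist u u = 0%E.
  rewrite (ell2_dist_lift us.2 us.2 (uniq_support T1)) ?big1 ?sqrtr0// => i _.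
  by rewrite subrr expr0n.
rewrite (ell2_dist_embeds us ut T1T T2T) => -[] /eqP.
rewrite sqrtr_eq0 => A0 /le_trans/(_ A0); rewrite leNgt => /negP; apply.
by rewrite divr_gt0// exprn_gt0// divr_gt0.
Qed.

Lemma exists_bilipschitz_embedding : exists2 F : borel_measure X R -> ell2 R,
  {in Bm Omega m &, injective F} &
  forall mu nu, Bm Omega m mu -> Bm Omega m nu ->
    (ell2_dist (F mu) (F nu)
       <= (Num.sqrt m%:R * ((2 * m ^ 2)%:R * (10 * 8 ^ n)%:R))%:E * Wb2 Omega
         mu nu)%E /\
    (Wb2 Omega mu nu
       <= (4 * 32 * Num.sqrt n.+1%:R)%:E * ell2_dist (F mu) (F nu))%E.
Proof.
have /choice[F FP] := exists_embedding.
exists F => [mu nu /set_mem Bmu /set_mem Bnu FE|mu nu Bmu Bnu].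
  have [s [T1 [smu sm us]]] := FP _ Bmu; have [t [T2 [tnu tm ut]]] := FP _ Bnu.
  by rewrite -FE in ut; exact: (embeds_inj smu tnu sm tm us ut).
have [s [T1 [smu sm us]]] := FP _ Bmu; have [t [T2 [tnu tm ut]]] := FP _ Bnu.
split; last exact: (lower smu tnu sm tm us ut).
apply: (upper _ smu tnu sm tm us ut).
(* The existence of an element of [Bm Omega m] forces [m] to be positive. *)
by case: Bmu => k /= /andP[k1 km] _; exact: leq_trans k1 km.
Qed.

End embedding.

(** * Distortion bounds and the theorem *)

Lemma Lip_le {R : realType} {S T : Type} (A : set S) (dS : S -> S -> \bar R)
    (dT : T -> T -> \bar R) (f : S -> T) (L : R) : 0 <= L ->
  (forall x y, A x -> A y -> (dT (f x) (f y) <= L%:E * dS x y)%E) ->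
  (Lip A dS dT f <= L%:E)%E.
Proof. by move=> L0 fL; apply: ereal_inf_lbound; exists L. Qed.

Lemma Lip_ge0 {R : realType} {S T : Type} (A : set S) (dS : S -> S -> \bar R)
    (dT : T -> T -> \bar R) (f : S -> T) : (0 <= Lip A dS dT f)%E.
Proof. by apply: le_ereal_inf_tmp => _ [L [L0 _] <-]; rewrite lee_fin. Qed.

Lemma distortion_le {R : realType} {S T : Type} (A : set S)
    (dS : S -> S -> \bar R) (dT : T -> T -> \bar R) (s0 : S) (f : S -> T)
    (L L' : R) : 0 <= L -> 0 <= L' -> {in A &, injective f} ->
  (forall x y, A x -> A y -> (dT (f x) (f y) <= L%:E * dS x y)%E /\
    (dS x y <= L'%:E * dT (f x) (f y))%E) ->
  (distortion A dS dT s0 f <= (L * L')%:E)%E.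
Proof.
move=> L0 L'0 injf LL'; rewrite /distortion EFinM.
apply: lee_pmul; [exact: Lip_ge0|exact: Lip_ge0|apply: Lip_le =>
  //|apply: Lip_le => //].
  by move=> x y Ax Ay; have [] := LL' x y Ax Ay.
move=> _ _ [x Ax <-] [y Ay <-].
by rewrite !pinvKV ?inE//; have [] := LL' x y Ax Ay.
Qed.

Theorem theorem1p1 (R : realType) (n : nat) :
  exists2 c : R, 1 <= c &
    forall Omega : set 'rV[R]_n,
      Omega !=set0 -> open Omega -> Omega <> setT ->
      forall m : nat,
        exists2 f : borel_measure 'rV[R]_n R -> ell2 R,
          bilipschitz (Bm Omega m) (Wb2 Omega) ell2_dist mzero f &
          (distortion (Bm Omega m) (Wb2 Omega) ell2_dist mzero f
            <= (c * m%:R `^ (n%:R + 5 / 2))%:E)%E.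
Proof.
(* The product of the two Lipschitz constants of [exists_bilipschitz_embedding] without its powers
   of [m]; 20 is 2 * 10. *)
exists (20 * (4 * 32) * 8 ^+ n * Num.sqrt n.+1%:R).
  have c1 : 1 <= 20 * (4 * 32) :> R by rewrite -!natrM ler1n.
  rewrite -[leLHS]mulr1 ler_pM//; last first.
    by rewrite -[leLHS]sqrtr1 ler_wsqrtr// ler1n.
  by rewrite -[leLHS]mulr1 ler_pM// exprn_ege1// ler1n.
move=> Omega _ oO OT m.
have [z0 Oz0] : exists z0, ~ Omega z0.
  by apply: contrapT => H; apply: OT; rewrite -subTset => z _;
    apply: contrapT => Oz; apply: H; exists z.
have [F injF FP] := @exists_bilipschitz_embedding R n Omega z0 m oO OT Oz0.
have dF : (distortion (Bm Omega m) (Wb2 Omega) ell2_dist mzero F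
    <= (20 * (4 * 32) * 8 ^+ n * Num.sqrt n.+1%:R
        * m%:R `^ (n%:R + 5 / 2))%:E)%E.
  apply: le_trans (distortion_le _ _ _ injF FP) _;
    rewrite ?mulr_ge0 ?sqrtr_ge0//.
  rewrite lee_fin.
  have -> : Num.sqrt m%:R * ((2 * m ^ 2)%:R * (10 * 8 ^ n)%:R)
      * (4 * 32 * Num.sqrt n.+1%:R)
      = 20 * (4 * 32) * 8 ^+ n * Num.sqrt n.+1%:R
        * (m%:R ^+ 2 * Num.sqrt m%:R) :> R.
    by rewrite !natrM !natrX; move: (4 * 32) => q; ring.
  rewrite ler_wpM2l ?mulr_ge0 ?exprn_ge0 ?sqrtr_ge0//.
  (* For [m = 0] the left side vanishes. For [m] at least 1 it is the power with exponent 5/2, and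
     adding [n] to the exponent does not decrease it. *)
  have [->|m0] := posnP m; first by rewrite expr0n mul0r powR_ge0.
  rewrite -powR_mulrn// -powR12_sqrt// -powRD;
    last by rewrite pnatr_eq0 -lt0n m0 implybT.
  by rewrite ler_powR ?ler1n//; have := ler0n R n; lra.
by exists F => //; split => //; apply: le_lt_trans dF _; exact: ltry.
Qed.
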